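(* Let $a<b$ be positive integers with $\gcd(a,b)=1$, write $b=na+r$ with $n\geq 1$ and $0<r<a$, and let $\mu=a-r$. Then there exists an irreducible plane curve $\Gamma\subset\mathbb{P}^2$ of degree $b$ having a cusp of type $(b-a;b)$ and a cusp of type $(\mu;a)$ and no other singularities.
   Context: Work over $\mathbb{C}$. A point $x$ of an irreducible plane curve $\Gamma\subset\mathbb{P}^2$ is called a cusp if exactly one point of the normalisation of $\Gamma$ maps to $x$. If $\nu$ is the multiplicity of $\Gamma$ at $x$, there is a unique line $L$ through $x$ whose intersection multiplicity $\mu'$ with $\Gamma$ at $x$ satisfies $\mu'>\nu$; the cusp is then said to be of type $(\nu;\mu')$. The case $\nu=1$ (a smooth point of $\Gamma$ whose tangent line has contact order $\mu'$) is allowed. The two cusps are different points of $\Gamma$. *)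

(* Defs.v *)
From HB Require Import structures.
From mathcomp Require Import all_boot all_order all_algebra.
From mathcomp Require Import generic_quotient ring_quotient fraction.
From mathcomp Require Import boolp classical_sets reals.
From mathcomp Require Import complex mpoly.

Set Implicit Arguments.
Unset Strict Implicit.
Unset Printing Implicit Defensive.

Import GRing.Theory.

Local Open Scope ring_scope.
Local Open Scope quotient_scope.

(* A point of P^2 is given by homogeneous coordinates; two points coincide when
   their coordinate vectors span the same line, i.e. when (x == y)%MS. *)
Record proj_plane (C : fieldType) := ProjPoint {
  coords :> 'rV[C]_3;
  coords_neq0 : coords != 0
}.

Definition principal_ideal (A : comNzRingType) (F : A) : {pred A} :=
  fun G => `[< exists Q : A, G = Q * F >].

(* An irreducible plane curve is given by a nonzero form generating a prime
   ideal, its homogeneous ideal.  As C[X0, X1, X2] is factorial, this means that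
   the form is an irreducible polynomial (cf. curve_eqn_irreducible). *)
Record plane_curve (C : fieldType) := PlaneCurve {
  curve_eqn : {mpoly C[3]};
  curve_degree : nat;
  curve_homog : curve_eqn \is curve_degree.-homog;
  curve_neq0 : curve_eqn != 0;
  curve_proper : 1 \notin principal_ideal curve_eqn;
  curve_prime : prime_idealr_closed (principal_ideal curve_eqn)
}.

Section PlaneCurves.

Variable C : fieldType.
Implicit Types (Gam : plane_curve C) (x y : proj_plane C).

Lemma curve_eqn_irreducible Gam :
  curve_eqn Gam \isn't a GRing.unit /\
  forall G H : {mpoly C[3]}, curve_eqn Gam = G * H ->
    (G \is a GRing.unit) || (H \is a GRing.unit).
Proof.
split.
  apply/negP=> uF; have /negP := curve_proper Gam; apply; apply/asboolP.
  by exists (curve_eqn Gam)^-1; rewrite mulVr.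
move=> G H FGH.
have FGH_in : G * H \in principal_ideal (curve_eqn Gam).
  by apply/asboolP; exists 1; rewrite mul1r FGH.
have F0 := curve_neq0 Gam.
have [/asboolP[Q QF]|/asboolP[Q QF]] := orP (curve_prime FGH_in).
- apply/orP; right; apply/unitrP; exists Q.
  have E : Q * H = 1.
    by apply: (mulIf F0); rewrite mul1r -mulrA (mulrC H) mulrA -QF -FGH.
  by split=> //; rewrite mulrC.
- apply/orP; left; apply/unitrP; exists Q.
  have E : Q * G = 1.
    by apply: (mulIf F0); rewrite mul1r -mulrA (mulrC G) mulrA -QF mulrC -FGH.
  by split=> //; rewrite mulrC.
Qed.

Definition curve_ideal Gam : {pred {mpoly C[3]}} :=
  principal_ideal (curve_eqn Gam).

Lemma curve_idealr_closed Gam : idealr_closed (curve_ideal Gam).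
Proof.
split; first by apply/asboolP; exists 0; rewrite mul0r.
  exact: curve_proper.
move=> a u v /asboolP[Q ->] /asboolP[Q' ->].
by apply/asboolP; exists (a * Q + Q'); rewrite mulrDl mulrA.
Qed.

HB.instance Definition _ Gam :=
  isIdealr.Build {mpoly C[3]} (curve_ideal Gam) (curve_idealr_closed Gam).
HB.instance Definition _ Gam :=
  isPrimeIdealrClosed.Build {mpoly C[3]} (curve_ideal Gam) (@curve_prime C Gam).

Definition homog_coord_ring Gam := {ideal_quot (curve_ideal Gam)}.

HB.instance Definition _ Gam := GRing.ComNzRing.on (homog_coord_ring Gam).
HB.instance Definition _ Gam :=
  NzRingQuotient.on (homog_coord_ring Gam).

Section IntegralDomain.
Variable Gam : plane_curve C.
Local Notation S := (homog_coord_ring Gam).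

Definition hcr_unit : {pred S} := fun u => `[< exists v : S, v * u = 1 >].

Definition hcr_inv (u : S) : S :=
  if pselect (exists v : S, v * u = 1) is left e then projT1 (cid e) else u.

Lemma hcr_mulVx : {in hcr_unit, left_inverse 1 hcr_inv *%R}.
Proof.
move=> u /asboolP e; rewrite /hcr_inv.
by case: pselect => // e'; case: (cid e').
Qed.

Lemma hcr_unitP (u v : S) : v * u = 1 -> hcr_unit u.
Proof. by move=> e; apply/asboolP; exists v. Qed.

Lemma hcr_invr_out : {in [predC hcr_unit], hcr_inv =1 id}.
Proof.
move=> u; rewrite inE => /negP nu; rewrite /hcr_inv.
by case: pselect => // e; case: nu; apply/asboolP.
Qed.

HB.instance Definition _ :=
  GRing.ComNzRing_hasMulInverse.Build S hcr_mulVx hcr_unitP hcr_invr_out.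

Lemma hcr_integral (u v : S) : u * v = 0 -> (u == 0) || (v == 0).
Proof. exact: Quotient.rquot_IdomainAxiom. Qed.

HB.instance Definition _ :=
  GRing.ComUnitRing_isIntegral.Build S hcr_integral.

End IntegralDomain.

Definition hcr_fraction Gam := {fraction (homog_coord_ring Gam)}.

HB.instance Definition _ Gam := GRing.Field.on (hcr_fraction Gam).

Definition hcr_class Gam (G : {mpoly C[3]}) : hcr_fraction Gam :=
  tofrac (\pi_(homog_coord_ring Gam) G : homog_coord_ring Gam).

Lemma hcr_class_is_zmod_morphism Gam : zmod_morphism (@hcr_class Gam).
Proof. by move=> G H; rewrite /hcr_class !rmorphB. Qed.

Lemma hcr_class_is_monoid_morphism Gam : monoid_morphism (@hcr_class Gam).
Proof.
by split=> [|G H]; rewrite /hcr_class; [rewrite !rmorph1|rewrite !rmorphM].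
Qed.

HB.instance Definition _ Gam :=
  GRing.isZmodMorphism.Build {mpoly C[3]} (hcr_fraction Gam)
    (@hcr_class Gam) (@hcr_class_is_zmod_morphism Gam).
HB.instance Definition _ Gam :=
  GRing.isMonoidMorphism.Build {mpoly C[3]} (hcr_fraction Gam)
    (@hcr_class Gam) (@hcr_class_is_monoid_morphism Gam).

Lemma hcr_class_eq0 Gam G : (hcr_class Gam G == 0) = (G \in curve_ideal Gam).
Proof.
rewrite /hcr_class tofrac_eq0 -[G in RHS]subr0 Quotient.idealrBE.
by rewrite -(rmorph0 \pi_(homog_coord_ring Gam)).
Qed.

Local Open Scope classical_set_scope.

(* The function field of the curve is the degree 0 part of the field of
   fractions of its homogeneous coordinate ring. *)
Definition function_field Gam : set (hcr_fraction Gam) :=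
  [set z | exists (d : nat) (G H : {mpoly C[3]}),
    [/\ G \is d.-homog, H \is d.-homog, hcr_class Gam H != 0
      & z = hcr_class Gam G / hcr_class Gam H]].

Arguments function_field : clear implicits.

Definition on_curve Gam x : Prop := (curve_eqn Gam).@[x 0] = 0.

(* The local ring of the curve at x and its maximal ideal; they are meaningful
   when x is on the curve, in which case H.@[x 0] != 0 forces
   hcr_class Gam H != 0. *)
Definition local_ring Gam x : {pred hcr_fraction Gam} :=
  fun z => `[< exists (d : nat) (G H : {mpoly C[3]}),
    [/\ G \is d.-homog, H \is d.-homog, H.@[x 0] != 0
      & z = hcr_class Gam G / hcr_class Gam H] >].

Arguments local_ring : clear implicits.

Definition local_maximal_ideal Gam x : set (hcr_fraction Gam) :=
  [set z | exists (d : nat) (G H : {mpoly C[3]}),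
    [/\ G \is d.-homog, H \is d.-homog, H.@[x 0] != 0, G.@[x 0] = 0
      & z = hcr_class Gam G / hcr_class Gam H]].

Arguments local_maximal_ideal : clear implicits.

Definition local_normalisation Gam x : set (hcr_fraction Gam) :=
  [set z | function_field Gam z /\
    exists p : {poly hcr_fraction Gam},
      [/\ p \is monic, p \is a polyOver (local_ring Gam x) & root p z]].

Arguments local_normalisation : clear implicits.

End PlaneCurves.
Arguments function_field {C} Gam.
Arguments local_ring {C} Gam x.
Arguments local_maximal_ideal {C} Gam x.
Arguments local_normalisation {C} Gam x.

Local Open Scope classical_set_scope.

Section Ideals.

Variable K : fieldType.
Implicit Types B I J M : set K.

(* B is meant to be (the carrier of) a subring of K. *)
Definition proper_ideal_of B I : Prop :=
  [/\ I `<=` B, I 0, (forall u v, I u -> I v -> I (u + v)),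
      (forall a u, B a -> I u -> I (a * u)) & ~ I 1].

Definition maximal_ideal_of B M : Prop :=
  proper_ideal_of B M /\
  forall J, proper_ideal_of B J -> M `<=` J -> J = M.

End Ideals.

Section Cusps.

Variable C : fieldType.
Implicit Types (Gam : plane_curve C) (x v : proj_plane C).

(* The fibre over x of the normalisation morphism of the curve: normalisation
   being local on the base, its points are the maximal ideals of the integral
   closure of the local ring at x which lie over the maximal ideal at x. *)
Definition normalisation_point_over Gam x (M : set (hcr_fraction Gam)) : Prop :=
  maximal_ideal_of (local_normalisation Gam x) M /\
  M `&` [set` local_ring Gam x] = local_maximal_ideal Gam x.

Definition is_cusp Gam x : Prop :=
  on_curve Gam x /\ exists! M, @normalisation_point_over Gam x M.

(* The equation of the curve near x, as a power series (here, a polynomial) in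
   the displacement from the representative of x; its order is the multiplicity
   of the curve at x, because the affine cone over the curve is, near that
   representative, the product of the curve with a line. *)
Definition taylor_at Gam x : {mpoly C[3]} :=
  curve_eqn Gam \mPo [tuple 'X_j + (x 0 j)%:MP | j < 3].

Definition multiplicity_ge Gam x (nu : nat) : Prop :=
  forall m : 'X_{1..3}, (mdeg m < nu)%N -> (taylor_at Gam x)@_m = 0.

Definition multiplicity Gam x (nu : nat) : Prop :=
  multiplicity_ge Gam x nu /\ ~ multiplicity_ge Gam x nu.+1.

Definition singular_point Gam x : Prop := multiplicity_ge Gam x 2.

(* The line through the distinct points x and v is parametrised by x + t v, and
   has x at t = 0. *)
Definition line_restriction Gam x v : {poly C} :=
  mmap (@polyC C) (fun j => (x 0 j)%:P + v 0 j *: 'X) (curve_eqn Gam).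

Definition line_contact_ge Gam x v (m : nat) : Prop :=
  'X^m %| line_restriction Gam x v.

(* Intersection multiplicity at x of the curve with the line through x and v;
   no m qualifies if that line is a component of the curve. *)
Definition line_contact Gam x v (m : nat) : Prop :=
  line_contact_ge Gam x v m /\ ~ line_contact_ge Gam x v m.+1.

(* The third clause says that the line L through x and v is the only line
   through x with intersection multiplicity > nu. *)
Definition cusp_of_type Gam x (nu mu' : nat) : Prop :=
  [/\ is_cusp Gam x, multiplicity Gam x nu & (nu < mu')%N /\
    exists v : proj_plane C,
      [/\ ~~ (x == v)%MS, line_contact Gam x v mu'
        & forall w : proj_plane C, ~~ (x == w)%MS ->
            line_contact_ge Gam x w nu.+1 ->
            (col_mx x w == col_mx x v)%MS]].

End Cusps.

(* Main.v *)
(* The curve is X0^b + X0^mu X1^(b-mu) + X1^(b-a) X2^a = 0, with cusps at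
   x = [0:0:1] and y = [0:1:0].  In the affine coordinates centred at x or y, call
   them al and be, its equation reads al^i = w be^j with w a unit of the local
   ring and i, j coprime.  Hence t = al^p / be^q, with p j - q i = 1, is integral,
   al and be are units times t^j and t^i, and every nonzero function is a power of t
   times an element of the form u + t a with u a unit of the local ring; so the
   normalisation has a single maximal ideal over the point, namely (t).  That only
   finitely many powers of t divide a nonzero function holds because the curve is
   finite over the be-axis, so that a function divides a nonzero polynomial in be. *)
Require Import Defs.
From mathcomp Require Import all_boot all_order all_algebra.
From mathcomp Require Import reals complex.
From mathcomp Require Import generic_quotient ring_quotient fraction.
From mathcomp Require Import boolp classical_sets mpoly.
From mathcomp Require Import ring zify.
From HB Require Import structures.

Set Implicit Arguments.
Unset Strict Implicit.
Unset Printing Implicit Defensive.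

Import GRing.Theory Num.Theory.

Local Open Scope ring_scope.

(** The binomial X0^b + X1^(b-a) X2^a = 0 alone has a cusp of type (b-a;b) at x and one of type
    (a;b) at y. The middle term X0^mu X1^(b-mu) repairs the second without disturbing the first: its
    ratio to X1^(b-a) X2^a is X0^mu X1^(a-mu) / X2^a, which vanishes at x, whereas at y the equation
    becomes X0^b + X0^mu + X2^a with mu < a < b. The two exponents there are coprime because gcd(mu,
    a) = gcd(r, a) = gcd(b, a). The obstacle is that the fibre of the normalisation is defined
    through the full integral closure of the local ring, for which no generators are known. The ring
    O[t] is not shown to be that closure: an element z of the closure is compared with O[t] by
    relations z e' = t^k e, with e and e' of the form u + t a, so that no such element ever has to
    be inverted. *)

Local Notation i0 := (ord0 : 'I_3).
Local Notation i1 := (Ordinal (isT : (1 < 3)%N)).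
Local Notation i2 := (Ordinal (isT : (2 < 3)%N)).

(** * Integral elements over a subring of a field *)

Section IntegralClosure.

Variables (K : fieldType) (O : {pred K}) (O_subring : subring_closed O).

HB.instance Definition _ := GRing.isSubringClosed.Build K O O_subring.

(** [integralOver] is relative to a ring morphism. Turning the predicate [O] into a type makes its
    inclusion [val] such a morphism, and closure under sums and products carries over. *)
Record subring_elt := SubringElt {
  subring_val : K;
  subring_valP : subring_val \in O
}.
HB.instance Definition _ := [isSub for subring_val].
HB.instance Definition _ := [Choice of subring_elt by <:].
HB.instance Definition _ := [SubChoice_isSubComNzRing of subring_elt by <:].

Definition integral_over (z : K) : Prop :=
  exists p : {poly K}, [/\ p \is monic, p \is a polyOver O & root p z].

Lemma integral_overE z :
  integral_over z <-> integralOver (val : subring_elt -> K) z.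
Proof.
split=> [[p [p_monic /polyOverP pO pz]]|[p p_monic pz]]; last first.
  exists (map_poly val p); split=> //; first exact: monic_map.
  by apply/polyOverP=> i; rewrite coef_map; apply: valP.
pose q : {poly subring_elt} := \poly_(i < size p) insubd 0 p`_i.
have qE : map_poly val q = p.
  apply/polyP=> i; rewrite coef_map coef_poly; case: ltnP => [_|?].
    by rewrite /= insubdK.
  by rewrite nth_default // raddf0.
exists q; last by rewrite qE.
apply/monicP/val_inj; rewrite -lead_coef_map_inj ?raddf0 //; last exact: val_inj.
by rewrite qE; apply/monicP.
Qed.

Lemma integral_overO z : z \in O -> integral_over z.
Proof.
move=> zO; apply/integral_overE.
by rewrite -[z]/(val (SubringElt zO)); apply: integral_id.
Qed.

Lemma integral_overD u v :
  integral_over u -> integral_over v -> integral_over (u + v).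
Proof.
by move=> /integral_overE ? /integral_overE ?; apply/integral_overE/integral_add.
Qed.

Lemma integral_overM u v :
  integral_over u -> integral_over v -> integral_over (u * v).
Proof.
by move=> /integral_overE ? /integral_overE ?; apply/integral_overE/integral_mul.
Qed.

Lemma integral_over_horner p z :
  p \is a polyOver O -> integral_over z -> integral_over p.[z].
Proof.
move=> pO zI; elim/poly_ind: p pO => [|p c IH] pO.
  by rewrite horner0; apply/integral_overO/rpred0.
have /polyOverP pcO := pO.
rewrite hornerMXaddC; apply: integral_overD; last first.
  apply: integral_overO.
  by have := pcO 0%N; rewrite coefD coefMX coefC /= add0r.
apply: integral_overM => //; apply: IH; apply/polyOverP => i.
by have := pcO i.+1; rewrite coefD coefMX coefC /= addr0.
Qed.

Lemma integral_over_root n z : (0 < n)%N -> z ^+ n \in O -> integral_over z.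
Proof.
move=> n_gt0 znO; exists ('X^n - (z ^+ n)%:P); split.
- by rewrite monicXnsubC.
- by rewrite rpredB ?polyOverXn // polyOverC.
- by rewrite /root !hornerE subrr.
Qed.

End IntegralClosure.

(** * A local domain whose two parameters satisfy a binomial equation *)

Section UnibranchPoint.

Local Open Scope classical_set_scope.

Variables (K : fieldType) (O : {pred K}) (m L : set K) (al be w : K) (i j : nat).
Hypothesis O_subring : subring_closed O.
Hypothesis mE :
  forall u, m u <-> exists f g, [/\ f \in O, g \in O & u = al * f + be * g].
Hypothesis m1 : ~ m 1.
Hypothesis O_local : forall u, u \in O -> ~ m u -> u^-1 \in O.
Hypothesis LE :
  forall z, L z <-> exists f g, [/\ f \in O, g \in O, g != 0 & z = f / g].
Hypotheses (alO : al \in O) (beO : be \in O) (al0 : al != 0) (be0 : be != 0).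
Hypotheses (wO : w \in O) (wVO : w^-1 \in O) (w0 : w != 0).
Hypotheses (i_gt0 : (0 < i)%N) (j_gt0 : (0 < j)%N) (ij : coprime i j).
Hypothesis branch : al ^+ i = w * be ^+ j.
Hypothesis O_dim1 :
  forall f, f \in O -> f != 0 -> exists k h, h \in O /\ f * h = be ^+ k.

HB.instance Definition _ := GRing.isSubringClosed.Build K O O_subring.

Let mM u v : m u -> v \in O -> m (u * v).
Proof.
move=> /mE[f [g [fO gO ->]]] vO; apply/mE; exists (f * v), (g * v).
by split; rewrite ?rpredM //; ring.
Qed.

Let mO u : m u -> u \in O.
Proof. by move=> /mE[f [g [fO gO ->]]]; rewrite rpredD ?rpredM. Qed.

Let mD u v : m u -> m v -> m (u + v).
Proof.
move=> /mE[f [g [fO gO ->]]] /mE[f' [g' [fO' gO' ->]]].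
by apply/mE; exists (f + f'), (g + g'); split; rewrite ?rpredD //; ring.
Qed.

Let m_al : m al.
Proof. by apply/mE; exists 1, 0; rewrite rpred0 rpred1 mulr1 mulr0 addr0. Qed.

Let m0 : m 0.
Proof. by rewrite -(mulr0 al); apply: mM => //; apply: rpred0. Qed.

(* [t] has valuation 1 when [al] and [be] have valuations [j] and [i]. *)
Lemma exists_uniformizer : exists t c d,
  [/\ L t, [/\ c \in O, c^-1 \in O, d \in O & d^-1 \in O],
      c != 0 /\ d != 0, t ^+ j = c * al & t ^+ i = d * be].
Proof.
case: (egcdnP i j_gt0) => p q; rewrite gcdnC (eqP ij) => pq _.
have ial (k : nat) : al ^+ k != 0 by rewrite expf_neq0.
have ibe (k : nat) : be ^+ k != 0 by rewrite expf_neq0.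
exists (al ^+ p / be ^+ q), (w ^+ q), (w ^+ p); split.
- by apply/LE; exists (al ^+ p), (be ^+ q); split; rewrite ?rpredX.
- by rewrite -!exprVn !rpredX.
- by rewrite !expf_neq0.
- rewrite expr_div_n -!exprM; apply: (canLR (mulfK (ibe _))).
  by rewrite pq exprD expr1 mulrAC [(q * i)%N]mulnC exprM branch exprMn -exprM (mulnC j).
- rewrite expr_div_n -!exprM; apply: (canLR (mulfK (ibe _))).
  rewrite mulnC exprM branch exprMn -exprM -mulrA -exprS; congr (_ * be ^+ _).
  by rewrite mulnC pq addn1.
Qed.

(** The candidate [P] is the set of elements of the closure [B] of positive order in [t]. A proper
    ideal of [B] containing [al] lies in [P]: an element outside [P] has a multiple in [U], and an
    element of [U] together with [al] generates the unit ideal. This gives both the maximality of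
    [P] and its uniqueness over [m]. *)
Lemma unique_maximal_ideal_over :
  exists! M, maximal_ideal_of [set z | L z /\ integral_over O z] M /\
             M `&` [set` O] = m.
Proof.
have [t [c [d [Lt [cO cVO dO dVO] [c0 d0] tj ti]]]] := exists_uniformizer.
have t0 : t != 0.
  by apply/eqP=> t0; move: tj => /eqP; rewrite t0 expr0n gtn_eqF // eq_sym
    mulf_eq0 (negPf c0) (negPf al0).
have alt : al = c^-1 * t ^+ j by rewrite tj mulKf.
have bet : be = d^-1 * t ^+ i by rewrite ti mulKf.
(* [A] is the ring O[t]; orders in [t] are computed in it. *)
pose A z := exists2 p : {poly K}, p \is a polyOver O & z = p.[t].
have AO z : z \in O -> A z.
  by move=> zO; exists z%:P; rewrite ?polyOverC ?hornerC.
have AD y z : A y -> A z -> A (y + z).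
  by move=> [p pO ->] [q qO ->]; exists (p + q); rewrite ?rpredD ?hornerD.
have AM y z : A y -> A z -> A (y * z).
  by move=> [p pO ->] [q qO ->]; exists (p * q); rewrite ?rpredM ?hornerM.
have At : A t by exists 'X; rewrite ?polyOverX ?hornerX.
have AX z k : A z -> A (z ^+ k).
  by move=> Az; elim: k => [|k IH]; [apply/AO/rpred1|rewrite exprS; apply: AM].
have tI : integral_over O t.
  by apply: (@integral_over_root _ _ O_subring j); rewrite ?tj ?rpredM.
have AI z : A z -> integral_over O z.
  by move=> [p pO ->]; apply: integral_over_horner.
have LO z : z \in O -> L z.
  by move=> zO; apply/LE; exists z, 1; rewrite rpred1 oner_neq0 divr1.
have LD y z : L y -> L z -> L (y + z).
  move=> /LE[f [g [fO gO g0 ->]]] /LE[f' [g' [fO' gO' g0' ->]]].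
  apply/LE; exists (f * g' + f' * g), (g * g').
  by rewrite rpredD ?rpredM // mulf_neq0 ?addf_div.
have LM y z : L y -> L z -> L (y * z).
  move=> /LE[f [g [fO gO g0 ->]]] /LE[f' [g' [fO' gO' g0' ->]]].
  apply/LE; exists (f * f'), (g * g').
  by rewrite ?rpredM // mulf_neq0 ?mulf_div.
have AL z : A z -> L z.
  move=> [p + ->]; elim/poly_ind: p => [|p b IH] pO.
    by rewrite horner0; apply/LO/rpred0.
  have /polyOverP pcO := pO.
  rewrite hornerMXaddC; apply/LD; last first.
    by apply/LO; have := pcO 0%N; rewrite coefD coefMX coefC /= add0r.
  apply/LM => //; apply: IH; apply/polyOverP => k.
  by have := pcO k.+1; rewrite coefD coefMX coefC /= addr0.
have m_tA u : m u -> exists2 a, A a & u = t * a.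
  move=> /mE[f [g [fO gO ->]]].
  exists (c^-1 * t ^+ j.-1 * f + d^-1 * t ^+ i.-1 * g).
    by apply/AD; repeat first [exact/AO|exact/At|apply/AM|apply/AX].
  by rewrite alt bet -[in LHS](prednK j_gt0) -[in LHS](prednK i_gt0) !exprS; ring.
(* Otherwise [1 / al] would be integral over a local ring where [al] vanishes. *)
have tA1 a : A a -> t * a = 1 -> False.
  move=> Aa ta1.
  have aljV : al^-1 = c * a ^+ j.
    have ca : al * (c * a ^+ j) = 1.
      by rewrite mulrA [al * c]mulrC -tj -exprMn ta1 expr1n.
    by apply: (mulfI al0); rewrite ca divff.
  have [p [/monicP lead1 /polyOverP pO /rootP pal]] : integral_over O al^-1.
    rewrite aljV; apply: integral_overM => //; first exact: integral_overO.
    by apply: AI; apply/AX.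
  have psz : (0 < size p)%N.
    by rewrite lt0n size_poly_eq0; apply/eqP=> p0; move: lead1 => /eqP;
      rewrite p0 lead_coef0 eq_sym oner_eq0.
  move: pal; rewrite horner_coef -(prednK psz) big_ord_recr /=.
  rewrite -[p`_ _]/(lead_coef p) lead1 mul1r => /(congr1 (fun z => z * al ^+ (size p).-1)).
  rewrite mul0r mulrDl -exprMn mulVf // expr1n => /eqP; rewrite addrC addr_eq0 => /eqP e1.
  apply: m1; rewrite e1 big_distrl /= -sumrN.
  elim/big_ind: _ => // k _.
  have -> : - (p`_k * al^-1 ^+ k * al ^+ (size p).-1)
     = al * (- (p`_k * al ^+ ((size p).-1 - k.+1))).
    have -> : al ^+ (size p).-1 = al ^+ k * (al * al ^+ ((size p).-1 - k.+1)).
      by rewrite -exprS -exprD; congr (_ ^+ _); rewrite subnSK ?subnKC // ltnW.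
    by rewrite exprVn -mulrA mulKf ?expf_neq0 // mulrCA mulrN.
  by apply: mM => //; rewrite rpredN rpredM ?rpredX.
(* Stand-ins for units of [A]: products stay in [U], and by [UtA] no element of [U] is a multiple of
   [t] in [A]. *)
pose U e := exists u a, [/\ u \in O, ~ m u, A a & e = u + t * a].
have UA e : U e -> A e.
  by move=> [u [a [uO _ Aa ->]]]; apply/AD; [apply/AO|apply/AM].
have UM e e' : U e -> U e' -> U (e * e').
  move=> [u [a [uO nmu Aa ->]]] [u' [a' [uO' nmu' Aa' ->]]].
  exists (u * u'), (u * a' + a * u' + t * (a * a')); split; last by ring.
  - by rewrite rpredM.
  - move=> muu; have u0 : u != 0 by apply/eqP=> u0; apply: nmu; rewrite u0.
    by apply: nmu'; rewrite -(mulKf u0 u') mulrC; apply: mM => //; apply: O_local.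
  - apply/AD; last by apply/AM => //; apply/AM.
    by apply/AD; apply/AM => //; apply/AO.
have U1 : U 1 by exists 1, 0; rewrite rpred1 mulr0 addr0; split=> //; apply/AO/rpred0.
have UX e k : U e -> U (e ^+ k).
  by move=> Ue; elim: k => [|k IH]; rewrite ?expr0 // exprS; apply/UM.
have UtA e a : U e -> A a -> e <> t * a.
  move=> [u [b [uO nmu Ab ->]]] Aa e1.
  have u0 : u != 0 by apply/eqP=> u0; apply: nmu; rewrite u0.
  apply: (tA1 ((a - b) * u^-1)); last first.
    by rewrite mulrA mulrBr -e1 addrK divff.
  apply/AM; last by apply/AO/O_local.
  by apply/AD => //; rewrite -mulN1r; apply/AM => //; apply/AO; rewrite rpredN rpred1.
have U0 e : U e -> e != 0.
  move=> Ue; apply/eqP=> e0; apply: (UtA e 0 Ue); first by apply/AO/rpred0.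
  by rewrite mulr0.
(* The constant coefficient [b] decides: inside [m] it is a multiple of [t] by [m_tA], outside [m]
   it is a unit of [O]. *)
have A_split z : A z -> U z \/ exists2 a, A a & z = t * a.
  move=> [p + ->]; elim/poly_ind: p => [|p b _] pO.
    by right; exists 0; rewrite ?horner0 ?mulr0 //; apply/AO/rpred0.
  have /polyOverP pcO := pO.
  have bO : b \in O by have := pcO 0%N; rewrite coefD coefMX coefC /= add0r.
  have pt : A p.[t].
    exists p => //; apply/polyOverP => k.
    by have := pcO k.+1; rewrite coefD coefMX coefC /= addr0.
  rewrite hornerMXaddC; case: (pselect (m b)) => [/m_tA[a Aa ->]|nmb].
    by right; exists (p.[t] + a); [apply/AD|ring].
  by left; exists b, p.[t]; split=> //; ring.
(* Nothing yet guarantees that dividing by [t] comes to an end, so the number of divisions is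
   bounded by [N]. *)
have A_order N z : A z ->
    (exists2 a, A a & z = t ^+ N * a) \/ exists k e, U e /\ z = t ^+ k * e.
  move=> Az; elim: N => [|N [[a Aa ->]|]]; last by right.
    by left; exists z; rewrite ?expr0 ?mul1r.
  case: (A_split a Aa) => [Ua|[a' Aa' ->]]; first by right; exists N, a.
  by left; exists a'; rewrite // exprSr mulrA.
have O_order f : f \in O -> f != 0 -> exists k e, U e /\ f = t ^+ k * e.
  move=> fO f0; have [k [h [hO fh]]] := O_dim1 fO f0.
  (* [f] divides be^k, which is a unit times t^(i k). One factor [t] more in [f] would make [t]
     invertible in [A], against [tA1]; hence the bound i k + 1. *)
  have [[a Aa fa]|//] := A_order (i * k).+1 f (AO f fO).
  case: (tA1 (a * h * d ^+ k)).
    by apply/AM; [apply/AM => //; apply/AO|apply/AX; apply/AO].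
  have ik0 : t ^+ (i * k) != 0 by rewrite expf_neq0.
  apply: (mulfI ik0); rewrite mulr1.
  transitivity ((f * h) * d ^+ k); first by rewrite fa exprS; ring.
  by rewrite fh bet exprMn -exprM mulrAC -exprMn mulVf // expr1n mul1r.
(* The common power of [t] is cancelled, so a positive [l] means a genuine pole of [z]. *)
have L_order z : L z -> z != 0 ->
    exists k l e e', [/\ U e, U e', minn k l = 0%N & z * (t ^+ l * e') = t ^+ k * e].
  move=> /LE[f [g [fO gO g0 ->]]]; rewrite mulf_eq0 invr_eq0 negb_or => /andP[f0 _].
  have [k [e [Ue fE]]] := O_order f fO f0.
  have [l [e' [Ue' gE]]] := O_order g gO g0.
  have kl : minn (k - l) (l - k) = 0%N by clear; lia.
  exists (k - l)%N, (l - k)%N, e, e'; split; [exact: Ue|exact: Ue'|exact: kl|].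
  have e0 := U0 _ Ue'; have tl (n : nat) : t ^+ n != 0 by rewrite expf_neq0.
  apply: (mulfI (tl (minn k l))).
  have E1 : t ^+ k = t ^+ minn k l * t ^+ (k - l).
    by rewrite -exprD; congr (_ ^+ _); clear; lia.
  have E2 : t ^+ l = t ^+ minn k l * t ^+ (l - k).
    by rewrite -exprD; congr (_ ^+ _); clear; lia.
  rewrite fE gE E1 E2.
  set x := t ^+ minn k l; set y := t ^+ (k - l); set x' := t ^+ (l - k).
  by field; rewrite e0 !tl.
pose B := [set z | L z /\ integral_over O z].
have BD y z : B y -> B z -> B (y + z).
  by move=> [? ?] [? ?]; split; [apply/LD|apply: integral_overD].
have BM y z : B y -> B z -> B (y * z).
  by move=> [? ?] [? ?]; split; [apply/LM|apply: integral_overM].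
have BA z : A z -> B z by move=> Az; split; [apply: AL|apply: AI].
have B_order z : B z -> z != 0 ->
    exists k e e', [/\ U e, U e' & z * e' = t ^+ k * e].
  move=> [Lz [p [/monicP lead1 /polyOverP pO /rootP pz]]] z0.
  have [k [l [e [e' [Ue Ue' kl zE]]]]] := L_order z Lz z0.
  case: l kl zE => [|l] kl zE.
    by exists k, e, e'; split=> //; rewrite -zE expr0 mul1r.
  have {kl}k0 : k = 0%N by move: kl; clear; lia.
  rewrite {}k0 expr0 mul1r in zE.
  have psz : (0 < size p)%N.
    by rewrite lt0n size_poly_eq0; apply/eqP=> p0; move: lead1 => /eqP;
      rewrite p0 lead_coef0 eq_sym oner_eq0.
  (* An integral element has no pole: z T = e with T = t^(l+1) e', and multiplying the integral
     equation of degree D by T^D writes e^D as a sum of terms each keeping a factor T. So [t]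
     divides e^D, against [UtA]. *)
  move: pz; rewrite horner_coef -(prednK psz) big_ord_recr /=.
  rewrite -[p`_ _]/(lead_coef p) lead1 mul1r.
  set D := (size p).-1 => /(congr1 (fun y => y * (t ^+ l.+1 * e') ^+ D)).
  rewrite mul0r mulrDl -exprMn zE => /eqP; rewrite addrC addr_eq0 => /eqP eD.
  suff [a Aa e1] : exists2 a, A a & e ^+ D = t * a.
    by case: (UtA (e ^+ D) a) => //; apply/UX.
  rewrite eD big_distrl /= -sumrN; elim/big_ind: _ => [|x y|n _].
  - by exists 0; rewrite ?mulr0 //; apply/AO/rpred0.
  - by move=> [a Aa ->] [a' Aa' ->]; exists (a + a'); rewrite ?mulrDr //; apply/AD.
  - exists (- (p`_n * e ^+ n * (t ^+ l * e') * (t ^+ l.+1 * e') ^+ (D - n.+1))).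
      rewrite -mulN1r; have ? := UA _ Ue; have ? := UA _ Ue'.
      by repeat first [assumption|apply/AM|apply/AX|apply/AO]; rewrite ?rpredN ?rpred1.
    have -> : (t ^+ l.+1 * e') ^+ D =
       (t ^+ l.+1 * e') ^+ n * ((t ^+ l.+1 * e') * (t ^+ l.+1 * e') ^+ (D - n.+1)).
      by rewrite -exprS -exprD; congr (_ ^+ _); rewrite subnSK ?subnKC // ltnW.
    have TE : t ^+ l.+1 * e' = t * (t ^+ l * e') by rewrite exprS mulrA.
    set T := t ^+ l.+1 * e' in zE TE *; set W := T ^+ (D - n.+1).
    clearbody W; clearbody T.
    transitivity (- (p`_n * (z * T) ^+ n * T * W)); first by rewrite exprMn; ring.
    by rewrite zE TE; ring.
(* The factor [e] plays the part of a denominator prime to [t]. *)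
pose P := [set z | B z /\ exists e a, [/\ U e, A a & e * z = t * a]].
have P_B : P `<=` B by move=> z [].
have not_P z : B z -> ~ P z -> exists e e', [/\ U e, U e' & z * e' = e].
  move=> Bz nPz; have [z0|z0] := eqVneq z 0.
    case: nPz; split=> //; exists 1, 0; split=> //; first by apply/AO/rpred0.
    by rewrite z0 !mulr0.
  have [k [e [e' [Ue Ue' zE]]]] := B_order z Bz z0.
  case: k zE => [|k] zE; first by exists e, e'; rewrite zE expr0 mul1r.
  case: nPz; split=> //; exists e', (t ^+ k * e); split=> //.
    by apply/AM; [apply/AX|apply/UA].
  by rewrite mulrC zE exprS mulrA.
have P_proper : proper_ideal_of B P.
  split=> //.
  - split; first by apply/BA; apply/AO/rpred0.
    by exists 1, 0; split=> //; [apply/AO/rpred0|rewrite !mulr0].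
  - move=> y z [By [e [a [Ue Aa eE]]]] [Bz [e' [a' [Ue' Aa' eE']]]].
    split; first exact: BD.
    exists (e * e'), (a * e' + a' * e); split; first exact: UM.
      by apply/AD; apply/AM => //; apply/UA.
    transitivity (e' * (e * y) + e * (e' * z)); first by ring.
    by rewrite eE eE'; ring.
  - move=> b z Bb [Bz [e [a [Ue Aa eE]]]]; split; first exact: BM.
    have [b0|b0] := eqVneq b 0.
      exists 1, 0; split=> //; first by apply/AO/rpred0.
      by rewrite b0 mul0r !mulr0.
    have [k [f [f' [Uf Uf' bE]]]] := B_order b Bb b0.
    exists (e * f'), (t ^+ k * f * a); split; first exact: UM.
      by apply/AM => //; apply/AM; [apply/AX|apply/UA].
    transitivity ((b * f') * (e * z)); first by ring.
    by rewrite bE eE; ring.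
  - move=> [_ [e [a [Ue Aa]]]]; rewrite mulr1; exact: UtA.
(* [u ^ j = e * s + (- t a) ^ j], and [t ^ j] is a multiple of [al]. *)
have no_U J e : proper_ideal_of B J -> J al -> U e -> ~ J e.
  move=> [JB J0 JD JM J1] Jal [u [a [uO nmu Aa ->]]] Je; apply: J1.
  have u0 : u != 0 by apply/eqP=> u0; apply: nmu; rewrite u0.
  have uV := O_local uO nmu.
  have ANa : A (- a).
    by rewrite -mulN1r; apply/AM => //; apply/AO; rewrite rpredN rpred1.
  have -> : 1 = u^-1 ^+ j * u ^+ j by rewrite -exprMn mulVf // expr1n.
  apply/JM; first by apply/BA/AO/rpredX.
  have -> : u ^+ j = (\sum_(k < j) u ^+ (j.-1 - k) * (t * - a) ^+ k) * (u + t * a)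
                     + (c * (- a) ^+ j) * al.
    have E : u ^+ j - (t * - a) ^+ j =
        (u + t * a) * \sum_(k < j) u ^+ (j.-1 - k) * (t * - a) ^+ k.
      by rewrite subrXX mulrN opprK.
    rewrite [X in X + _]mulrC -E [c * _]mulrC -mulrA -tj -exprMn [- a * t]mulrC.
    by rewrite subrK.
  apply/JD; apply/JM => //; apply/BA.
    elim/big_ind: _ => [||k _]; [exact/AO/rpred0|exact: AD|].
    by apply/AM; apply/AX; [apply/AO|apply/AM].
  by apply/AM; [apply/AO|apply/AX].
have J_P J : proper_ideal_of B J -> J al -> J `<=` P.
  move=> Jp Jal z Jz; apply: contrapT => nPz.
  have [JB _ _ JM _] := Jp.
  have [e [e' [Ue Ue' zE]]] := not_P z (JB _ Jz) nPz.
  by apply: (no_U _ _ Jp Jal Ue); rewrite -zE mulrC; apply/JM => //; apply/BA/UA.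
have P_m : P `&` [set` O] = m.
  apply/seteqP; split=> z /=; last first.
    move=> mz; split; last exact: mO.
    have [a Aa za] := m_tA z mz.
    split; first by apply/BA/AO/mO.
    by exists 1, a; split=> //; rewrite mul1r.
  move=> [[_ [e [a [Ue Aa eE]]]] zO]; apply: contrapT => nmz.
  apply: (UtA (e * z) a) => //; apply/UM => //.
  by exists z, 0; rewrite mulr0 addr0; split=> //; apply/AO/rpred0.
have P_al : P al by have [] : (P `&` [set` O]) al by rewrite P_m.
exists P; split.
  split=> //; split=> // J Jp PJ; apply/seteqP; split=> //.
  by apply: J_P => //; apply: PJ.
move=> M [[Mp Mmax] Mm]; apply: Mmax => //; apply: J_P => //.
by have [] : (M `&` [set` O]) al by rewrite Mm.
Qed.

End UnibranchPoint.

(** * Polynomials in three variables *)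

Lemma big_ord3 (T : Type) (idx : T) (op : Monoid.law idx) (F : 'I_3 -> T) :
  \big[op/idx]_i F i = op (F i0) (op (F i1) (F i2)).
Proof.
rewrite !big_ord_recl big_ord0 Monoid.mulm1.
by congr (op _ (op (F _) (F _))); apply: val_inj.
Qed.

Lemma mnm3P (m m' : 'X_{1..3}) :
  [/\ m i0 = m' i0, m i1 = m' i1 & m i2 = m' i2] -> m = m'.
Proof.
move=> [e0 e1 e2]; apply/mnmP => -[[|[|[|//]]] lt_i].
- by rewrite (_ : Ordinal _ = i0) //; apply: val_inj.
- by rewrite (_ : Ordinal _ = i1) //; apply: val_inj.
- by rewrite (_ : Ordinal _ = i2) //; apply: val_inj.
Qed.

(** The universal property of the polynomial ring, in existential form so that only these equations
    describe the morphism. *)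
Lemma mpoly3_hom (C : fieldType) (S : comNzRingType) (f : {rmorphism C -> S})
    (h : 'I_3 -> S) :
  exists Psi : {rmorphism {mpoly C[3]} -> S},
    [/\ forall c G, Psi (c *: G) = f c * Psi G, forall i, Psi 'X_i = h i
      & forall m, Psi 'X_[m] = h i0 ^+ m i0 * h i1 ^+ m i1 * h i2 ^+ m i2].
Proof.
exists (mmap f h : {rmorphism _ -> _}); split=> [c G|i|m] /=; first exact: mmapZ.
  by rewrite mmapX mmap1U.
by rewrite mmapX /mmap1 big_ord3 /= mulrA.
Qed.

(** * The trinomial and its primality *)

Section Trinomial.

Variables (C : fieldType) (a b mu : nat).
Hypotheses (mu_gt0 : (0 < mu)%N) (mu_lt_a : (mu < a)%N) (a_lt_b : (a < b)%N).
Hypothesis co_ab : coprime a b.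

Definition trinomial : {mpoly C[3]} :=
  'X_i0 ^+ b + 'X_i0 ^+ mu * 'X_i1 ^+ (b - mu) + 'X_i1 ^+ (b - a) * 'X_i2 ^+ a.
Local Notation F := trinomial.

Lemma trinomial_homog : F \is b.-homog.
Proof.
have X_homog (i : 'I_3) : ('X_i : {mpoly C[3]}) \is 1.-homog.
  by rewrite dhomogX /= mdeg1.
have H k (i : 'I_3) : ('X_i ^+ k : {mpoly C[3]}) \is k.-homog.
  by have := dhomogMn k (X_homog i); rewrite mul1n.
rewrite /F; apply: rpredD; first apply: rpredD => //.
  by have := dhomogM (H mu i0) (H (b - mu)%N i1); rewrite subnKC // ltnW // (ltn_trans mu_lt_a).
by have := dhomogM (H (b - a)%N i1) (H a i2); rewrite subnK // ltnW.
Qed.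

(* Give 'X_i0, 'X_i1, 'X_i2 the weights a, 0, b, recorded by the exponent of the
   variable of {poly _} in [Psi], and let [phi] parametrise the surface
   'X_i0 ^+ b + 'X_i1 ^+ (b - a) * 'X_i2 ^+ a = 0 cut out by the leading form of
   the trinomial.  [phi] kills no nonzero polynomial of degree < b in 'X_i0, so
   after [phi] the weighted degree of such a polynomial is unchanged while that
   of the trinomial drops. *)
Section Primality.

Variable eps : C.
Hypothesis eps_b : eps ^+ b = -1.

Let wdeg (m : 'X_{1..3}) := (a * m i0 + b * m i2)%N.

Variable Psi : {rmorphism {mpoly C[3]} -> {poly {mpoly C[3]}}}.
Hypothesis PsiZ : forall c G, Psi (c *: G) = c%:MP%:P * Psi G.
Hypothesis PsiX : forall m, Psi 'X_[m] = ('X_[m])%:P * 'X^(wdeg m).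

(** [Psi] sorts the monomials of [G] by weight without merging any two of them; it is therefore
    injective. *)
Let coef_Psi G k m : ((Psi G)`_k)@_m = G@_m *+ (k == wdeg m).
Proof.
elim/mpolyind: G => [|c m' G _ _ IH]; first by rewrite raddf0 coef0 mcoeff0 mul0rn.
rewrite raddfD /= coefD [in LHS]mcoeffD IH [in RHS]mcoeffD mulrnDl.
congr (_ + _); rewrite PsiZ PsiX /= mulrA -polyCM coefCM.
rewrite mul_mpolyC coefXn -scalerAl -mulr_natr mcoeffZ mcoeffZ.
have [->|km'] := eqVneq k (wdeg m'); rewrite ?mulr1 ?mulr0.
  rewrite mcoeffX; case: eqP => [->|_]; first by rewrite eqxx mulr1n.
  by rewrite mulr0 mul0rn.
rewrite mcoeff0 mulr0 mcoeffX; case: eqP => [<-|_]; last by rewrite mulr0 mul0rn.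
by rewrite (negPf km') mulr0n.
Qed.

Let Psi_inj G : Psi G = 0 -> G = 0.
Proof.
move=> G0; apply/mpolyP=> m; have := coef_Psi G (wdeg m) m.
by rewrite G0 coef0 mcoeff0 eqxx.
Qed.

Let nu (m : 'X_{1..3}) : 'X_{1..3} :=
  (U_(i1) *+ ((b - a) * m i0 + b * m i1) + U_(i2) *+ (a * m i0 + b * m i2))%MM.

Variable phi : {rmorphism {mpoly C[3]} -> {mpoly C[3]}}.
Hypothesis phiZ : forall c G, phi (c *: G) = c *: phi G.
Hypothesis phiX : forall m, phi 'X_[m] = eps ^+ m i0 *: 'X_[nu m].

Definition reduced (G : {mpoly C[3]}) := forall m : 'X_{1..3}, G@_m != 0 -> (m i0 < b)%N.

(** [nu m] is the exponent of the image of 'X_[m] under [phi]. Its component at [i2] is a m_0 modulo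
    b, and [a] is invertible modulo [b], so it determines m_0 below b; the other two exponents
    follow. *)
Let nu_inj (m m' : 'X_{1..3}) : (m i0 < b)%N -> (m' i0 < b)%N -> nu m = nu m' -> m = m'.
Proof.
move=> mb mb' e.
have e1 : ((b - a) * m i0 + b * m i1 = (b - a) * m' i0 + b * m' i1)%N.
  by have := congr1 (fun n : 'X_{1..3} => n i1) e;
     rewrite /nu !mnmDE !mulmnE !mnm1E /= !(mul1n, muln1, mul0n, muln0, addn0, add0n).
have e2 : (a * m i0 + b * m i2 = a * m' i0 + b * m' i2)%N.
  by have := congr1 (fun n : 'X_{1..3} => n i2) e;
     rewrite /nu !mnmDE !mulmnE !mnm1E /= !(mul1n, muln1, mul0n, muln0, addn0, add0n).
have b_gt0 : (0 < b)%N by lia.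
have e0 : m i0 = m' i0.
  have /eqP : (a * m i0 = a * m' i0 %[mod b])%N.
    by rewrite -(modnMDl (m i2)) -[in RHS](modnMDl (m' i2)) mulnC addnC e2 addnC [(b * _)%N]mulnC.
  wlog le_m : m m' mb mb' {e e1 e2} / (m i0 <= m' i0)%N.
    by move=> W E; case/orP: (leq_total (m i0) (m' i0)) => ?; [|apply/esym];
       apply: W; rewrite // eq_sym.
  rewrite eq_sym eqn_mod_dvd ?leq_mul2l ?le_m ?orbT // -mulnBr Gauss_dvdr 1?coprime_sym //.
  case: (posnP (m' i0 - m i0)) => [|d_gt0 /(dvdn_leq d_gt0)]; lia.
rewrite e0 in e1 e2; apply: mnm3P; split=> //.
  by move/eqP: e1; rewrite eqn_add2l eqn_pmul2l // => /eqP.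
by move/eqP: e2; rewrite eqn_add2l eqn_pmul2l // => /eqP.
Qed.

Let eps0 : eps != 0.
Proof.
apply/eqP=> e0; move: eps_b => /eqP.
have -> : b = b.-1.+1 by move: a_lt_b; clear; lia.
by rewrite e0 expr0n eq_sym oppr_eq0 oner_eq0.
Qed.

(** By [nu_inj] distinct monomials of a reduced polynomial have distinct images, so nothing can
    cancel. *)
Let phi_reduced G : reduced G -> phi G = 0 -> G = 0.
Proof.
move=> Gred phi0; apply/mpolyP=> m; rewrite mcoeff0; apply/eqP/negPn/negP=> Gm.
have := congr1 (mcoeff (nu m)) phi0; rewrite mcoeff0.
rewrite [G in phi G]mpolyE raddf_sum /= raddf_sum /=.
rewrite (bigD1_seq m) ?msupp_uniq ?mcoeff_msupp //= big_seq_cond big1 ?addr0; last first.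
  move=> m' /andP[m'G mm']; rewrite phiZ phiX.
  rewrite !mcoeffZ mcoeffX; case: eqP => [e|_]; last by rewrite !mulr0.
  case/negP: mm'; apply/eqP/(nu_inj _ _ e); last exact: Gred.
  by apply: Gred; rewrite -mcoeff_msupp.
rewrite phiZ phiX.
rewrite !mcoeffZ mcoeffX eqxx mulr1 => /eqP.
by rewrite mulf_eq0 (negPf Gm) expf_eq0 (negPf eps0) andbF.
Qed.

Let Phi G := map_poly phi (Psi G).

Let size_Phi G : reduced G -> size (Phi G) = size (Psi G).
Proof.
move=> Gred; have [G0|G0] := eqVneq (Psi G) 0; first by rewrite /Phi G0 rmorph0.
apply: size_map_poly_id0; apply/eqP => /phi_reduced lead0.
move: G0; rewrite -lead_coef_eq0 => /eqP; apply.
apply: lead0 => m; rewrite /lead_coef coef_Psi => Gm; apply: Gred.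
by apply/eqP=> Gm0; move: Gm; rewrite Gm0 mul0rn eqxx.
Qed.

Let M0 : 'X_{1..3} := (U_(i0) *+ b)%MM.
Let M1 : 'X_{1..3} := (U_(i0) *+ mu + U_(i1) *+ (b - mu))%MM.
Let M2 : 'X_{1..3} := (U_(i1) *+ (b - a) + U_(i2) *+ a)%MM.

Let FE : F = 'X_[M0] + 'X_[M1] + 'X_[M2].
Proof. by rewrite /F /M1 /M2 !mpolyXD -!mpolyXn. Qed.

Let PsiF : Psi F = ('X_[M0] + 'X_[M2])%:P * 'X^(a * b) + ('X_[M1])%:P * 'X^(a * mu).
Proof.
rewrite FE !raddfD /= !PsiX /wdeg /M0 /M1 /M2 !mnmDE !mulmnE !mnm1E /=.
rewrite !(mul1n, mul0n, muln0, addn0, add0n) [(b * a)%N]mulnC mulrDl.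
by rewrite addrAC.
Qed.

Let size_PsiF : size (Psi F) = (a * b).+1.
Proof.
have X0 : 'X_[M0] + 'X_[M2] != 0 :> {mpoly C[3]}.
  apply/eqP=> /(congr1 (mcoeff M0)); rewrite mcoeffD !mcoeffX mcoeff0 eqxx.
  rewrite (_ : (M2 == M0) = false) ?addr0; first by apply/eqP/oner_neq0.
  apply/eqP=> /(congr1 (fun m : 'X_{1..3} => m i0)).
  by rewrite /M0 /M2 !mnmDE !mulmnE !mnm1E /=; lia.
have X1 : 'X_[M1] != 0 :> {mpoly C[3]}.
  apply/eqP=> /(congr1 (mcoeff M1)); rewrite mcoeffX mcoeff0 eqxx.
  by apply/eqP/oner_neq0.
rewrite PsiF size_polyDl !size_Cmul // !size_polyXn // ltnS ltn_pmul2l //; lia.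
Qed.

Let size_PhiF : (size (Phi F) <= a * b)%N.
Proof.
have -> : Phi F = (phi 'X_[M1])%:P * 'X^(a * mu).
  have M0i : M0 i0 = b by rewrite /M0 mulmnE mnm1E mul1n.
  have M2i : M2 i0 = 0%N by rewrite /M2 mnmDE !mulmnE !mnm1E.
  have nuM : nu M0 = nu M2.
    rewrite /nu M0i M2i; apply/mnm3P; rewrite /M0 /M2 !mnmDE !mulmnE !mnm1E /=.
    by split; lia.
  (* Since eps^b = -1, the two monomials of the leading form have opposite images. *)
  have phi02 : phi ('X_[M0] + 'X_[M2]) = 0.
    rewrite raddfD /= !phiX nuM M0i M2i eps_b expr0 scale1r scaleN1r.
    exact: addNr.
  rewrite /Phi PsiF.
  rewrite rmorphD !rmorphM /= !map_polyC /= !map_polyXn.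
  by rewrite phi02 mul0r add0r.
rewrite mul_polyC; apply: (leq_trans (size_scale_leq _ _)).
rewrite (size_polyXn _ (a * mu)).
by rewrite ltn_pmul2l //; lia.
Qed.

(** As a polynomial in 'X_i0, [F] is monic of degree b with remaining terms of degrees mu and 0, so
    multiples of 'X_i0 ^+ b can be rewritten into terms of smaller degree. *)
Lemma trinomial_division G : exists Q G', reduced G' /\ G = Q * F + G'.
Proof.
pose D G := exists Q G', reduced G' /\ G = Q * F + G'.
have DD G1 G2 : D G1 -> D G2 -> D (G1 + G2).
  move=> [Q1 [G1' [r1 ->]]] [Q2 [G2' [r2 ->]]]; exists (Q1 + Q2), (G1' + G2').
  split; last by ring.
  move=> m; rewrite mcoeffD => sm.
  have [e1|/r1//] := eqVneq G1'@_m 0.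
  by apply: r2; rewrite e1 add0r in sm.
have DZ c G1 : D G1 -> D (c *: G1).
  move=> [Q1 [G1' [r1 ->]]]; exists (c *: Q1), (c *: G1').
  split; last by rewrite scalerDr scalerAl.
  by move=> m; rewrite mcoeffZ mulf_eq0 negb_or => /andP[_ /r1].
have DX N (m : 'X_{1..3}) : (m i0 < N)%N -> D 'X_[m].
  elim: N m => // N IH m mN; have [mb|bm] := ltnP (m i0) b.
    exists 0, 'X_[m]; split; last by rewrite mul0r add0r.
    by move=> m'; rewrite mcoeffX; case: (m =P m') => [<- //|_]; rewrite eqxx.
  pose m' := (m - M0)%MM.
  have mE : m = (m' + M0)%MM.
    apply/mnm3P; rewrite /m' /M0 !mnmDE !mnmBE !mulmnE !mnm1E /=.
    by split; lia.
  have -> : 'X_[m] = 'X_[m'] * F + (-1) *: ('X_[(m' + M1)%MM] + 'X_[(m' + M2)%MM]).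
    by rewrite FE [in LHS]mE !mpolyXD scaleN1r; ring.
  have mi : m i0 = (m' i0 + b)%N by rewrite mE /M0 mnmDE mulmnE mnm1E mul1n.
  apply/DD.
    exists 'X_[m'], 0; rewrite addr0; split=> // k.
    by rewrite mcoeff0 eqxx.
  apply/DZ; apply/DD; apply: IH;
    rewrite /M1 /M2 !mnmDE !mulmnE !mnm1E /= ?mul1n ?mul0n; lia.
elim/mpolyind: G => [|c m G _ _ DG]; last by apply/DD => //; apply/DZ/(DX (m i0).+1).
exists 0, 0; rewrite mul0r addr0; split=> // m.
by rewrite mcoeff0 eqxx.
Qed.

(** If both remainders are nonzero, their product is some Q F. Applying [phi] keeps the weighted
    degrees of the remainders, does not raise that of [Q] and lowers that of [F], so the degrees of
    the two sides no longer match. *)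
Lemma trinomial_prime_aux G H :
  G * H \in principal_ideal F ->
  (G \in principal_ideal F) || (H \in principal_ideal F).
Proof.
move=> /asboolP[Q0 GHQ].
have [Q1 [G' [rG GE]]] := trinomial_division G.
have [Q2 [H' [rH HE]]] := trinomial_division H.
have [G0|G0] := eqVneq G' 0.
  by apply/orP; left; apply/asboolP; exists Q1; rewrite GE G0 addr0.
have [H0|H0] := eqVneq H' 0.
  by apply/orP; right; apply/asboolP; exists Q2; rewrite HE H0 addr0.
exfalso; have [Q GHE] : exists Q, G' * H' = Q * F.
  exists (Q0 - Q1 * H' - Q2 * G' - Q1 * Q2 * F).
  by rewrite !mulrBl -GHQ GE HE; ring.
have nz G1 : G1 != 0 -> Psi G1 != 0 by apply: contra => /eqP/Psi_inj ->.
have Q_neq0 : Q != 0.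
  by apply/eqP=> Q0'; move/eqP: GHE; rewrite Q0' mul0r mulf_eq0 (negPf G0) (negPf H0).
have F_neq0 : Psi F != 0 by rewrite -size_poly_eq0 size_PsiF.
have sG : (0 < size (Psi G'))%N by rewrite size_poly_gt0 nz.
have sH : (0 < size (Psi H'))%N by rewrite size_poly_gt0 nz.
have szPsi : (size (Psi G') + size (Psi H')).-1 = (size (Psi Q) + a * b)%N.
  have := congr1 (fun P => size (Psi P)) GHE.
  rewrite !rmorphM /= (size_mul (nz _ G0) (nz _ H0)).
  by rewrite (size_mul (nz _ Q_neq0) F_neq0) size_PsiF addnS.
have PG : Phi G' != 0 by rewrite -size_poly_eq0 size_Phi // size_poly_eq0 nz.
have PH : Phi H' != 0 by rewrite -size_poly_eq0 size_Phi // size_poly_eq0 nz.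
have szPhi : (size (Psi G') + size (Psi H')).-1 = size (Phi Q * Phi F).
  have := congr1 (fun P => size (Phi P)) GHE.
  by rewrite /Phi !rmorphM /= -/(Phi _) -/(Phi _) size_mul // !size_Phi.
have := size_polyMleq (Phi Q) (Phi F); rewrite -szPhi szPsi.
have : (size (Phi Q) <= size (Psi Q))%N by apply: size_poly.
by move: size_PhiF sG sH szPsi; clear; lia.
Qed.

End Primality.

Lemma trinomial_prime (eps : C) G H : eps ^+ b = -1 ->
  G * H \in principal_ideal F ->
  (G \in principal_ideal F) || (H \in principal_ideal F).
Proof.
move=> eps_b.
have [Psi [PsiZ _ PsiX]] := mpoly3_hom (polyC \o @mpolyC 3 C)
  (fun i => ('X_i)%:P * 'X^(nth 0%N [:: a; 0%N; b] i)).
have [phi [phiZ _ phiX]] := mpoly3_hom (@mpolyC 3 C)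
  (fun i => nth 0 [:: eps *: ('X_i1 ^+ (b - a) * 'X_i2 ^+ a); 'X_i1 ^+ b; 'X_i2 ^+ b] i).
apply: (@trinomial_prime_aux eps eps_b Psi PsiZ _ phi).
- move=> m; rewrite PsiX /= expr0 mulr1 !exprMn -!exprM exprD.
  have -> : 'X_[m] = 'X_i0 ^+ m i0 * 'X_i1 ^+ m i1 * 'X_i2 ^+ m i2 :> {mpoly C[3]}.
    by rewrite mpolyXE_id big_ord3 /= mulrA.
  rewrite !rmorphM /= !rmorphXn /=.
  move: (('X_i0)%:P ^+ _) (('X_i1)%:P ^+ _) (('X_i2)%:P ^+ _) ('X^_) ('X^_) => *.
  by ring.
- by move=> c P; rewrite phiZ mul_mpolyC.
- move=> m; rewrite phiX /= mpolyXD -!mpolyXn exprZn -!scalerAl; congr (_ *: _).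
  rewrite !exprD !exprM exprMn.
  move: ('X_i1 ^+ _ ^+ _) ('X_i2 ^+ _ ^+ _) ('X_i1 ^+ _ ^+ _) ('X_i2 ^+ _ ^+ _) => *.
  by ring.
Qed.

End Trinomial.

(** * The local ring of a plane curve at a coordinate point *)

(** An equation of z is divided by its variable, as z is nonzero, until its constant term has
    nonzero image; z divides this constant term. It replaces the norm as a way to find a nonzero
    multiple of z in the base ring. *)
Lemma integral_cofactor (R : comNzRingType) (K : fieldType)
    (f : {rmorphism R -> K}) (z : K) :
  z != 0 -> integralOver f z ->
  exists (c : R) (q : {poly R}), f c != 0 /\ f c = z * (map_poly f q).[z].
Proof.
move=> z0 [p p_monic]; have : map_poly f p != 0.
  by rewrite monic_neq0 // monic_map.
elim/poly_ind: p {p_monic} => [|p c IH]; first by rewrite rmorph0 eqxx.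
rewrite rmorphD rmorphM /= map_polyX map_polyC /= /root hornerMXaddC.
have [fc0|fc0 _ /eqP pz] := eqVneq (f c) 0; last first.
  exists c, (- p); split=> //; rewrite rmorphN /= hornerN mulrN.
  by apply/eqP; rewrite -addr_eq0 addrC mulrC pz.
rewrite fc0 polyC0 !addr0 => pX0; rewrite mulf_eq0 (negPf z0) orbF.
by apply: IH; apply: contraNneq pX0 => ->; rewrite mul0r.
Qed.

(* [K], [cls], [O], [m] and [L] are the fraction field, the class map, the local
   ring, its maximal ideal and the function field of a plane curve through [x].
   They are kept abstract because conversion in [hcr_fraction] is intractable. *)
Section LocalRing.

Local Open Scope classical_set_scope.

Variables (C K : fieldType) (cls : {rmorphism {mpoly C[3]} -> K}) (x : 'rV[C]_3).
Variables (O : {pred K}) (m L : set K).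
Hypothesis cls_vanish : forall H, cls H = 0 -> H.@[x 0] = 0.
Hypothesis OE : forall z, z \in O <->
  exists (d : nat) (G H : {mpoly C[3]}),
    [/\ G \is d.-homog, H \is d.-homog, H.@[x 0] != 0 & z = cls G / cls H].
Hypothesis mE : forall z, m z <->
  exists (d : nat) (G H : {mpoly C[3]}),
    [/\ G \is d.-homog, H \is d.-homog, H.@[x 0] != 0, G.@[x 0] = 0
      & z = cls G / cls H].
Hypothesis LE : forall z, L z <->
  exists (d : nat) (G H : {mpoly C[3]}),
    [/\ G \is d.-homog, H \is d.-homog, cls H != 0 & z = cls G / cls H].

Lemma cls_neq0 H : H.@[x 0] != 0 -> cls H != 0.
Proof. by apply: contra => /eqP H0; rewrite cls_vanish. Qed.

Lemma local_ringP (d : nat) (G H : {mpoly C[3]}) :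
  G \is d.-homog -> H \is d.-homog -> H.@[x 0] != 0 -> cls G / cls H \in O.
Proof. by move=> ? ? ?; apply/OE; exists d, G, H. Qed.

Lemma local_ring_subring : subring_closed O.
Proof.
split=> [|_ _ /OE[d [G [H [dG dH Hx ->]]]] /OE[d' [G' [H' [dG' dH' Hx' ->]]]]
         |_ _ /OE[d [G [H [dG dH Hx ->]]]] /OE[d' [G' [H' [dG' dH' Hx' ->]]]]].
- apply/OE; exists 0%N, 1, 1; rewrite dhomog1 meval1 oner_neq0; split=> //.
  by rewrite rmorph1 divr1.
- apply/OE; exists (d + d')%N, (G * H' - G' * H), (H * H').
  have dGH' := dhomogM dG dH'; have := dhomogM dG' dH; rewrite addnC => dGH.
  rewrite mevalM mulf_neq0 // (dhomogM dH dH') rpredB //.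
  split=> //; rewrite rmorphB !rmorphM /=.
  by field; rewrite !cls_neq0.
- apply/OE; exists (d + d')%N, (G * G'), (H * H').
  rewrite mevalM mulf_neq0 // (dhomogM dG dG') (dhomogM dH dH'); split=> //.
  by rewrite !rmorphM /= mulf_div.
Qed.

HB.instance Definition _ := GRing.isSubringClosed.Build K O local_ring_subring.

Lemma local_ring_inv u : u \in O -> ~ m u -> u^-1 \in O.
Proof.
move=> /OE[d [G [H [dG dH Hx ->]]]] nm; rewrite invf_div.
apply: (local_ringP dH dG); apply/eqP=> Gx; apply: nm.
by apply/mE; exists d, G, H.
Qed.

Lemma local_maximal_ideal1 : ~ m 1.
Proof.
move=> /mE[d [G [H [_ _ Hx Gx /eqP]]]]; rewrite eq_sym => /eqP GH.
have {GH} : cls (G - H) == 0.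
  by rewrite rmorphB subr_eq0 -[cls G](divfK (cls_neq0 Hx)) GH mul1r.
move/eqP/cls_vanish/eqP.
by rewrite mevalB Gx sub0r oppr_eq0 (negPf Hx).
Qed.

Variables (i j k : 'I_3).
Hypothesis ijk : forall l, [\/ l = i, l = j | l = k].
Hypotheses (xi : x 0 i = 0) (xj : x 0 j = 0) (xk : x 0 k = 1).
Local Notation coord l := (cls 'X_l / cls 'X_k).
Local Notation al := (coord i).
Local Notation be := (coord j).

Let X_homog (l : 'I_3) : ('X_l : {mpoly C[3]}) \is 1.-homog.
Proof. by rewrite dhomogX /= mdeg1. Qed.

Let Xkx : ('X_k : {mpoly C[3]}).@[x 0] != 0.
Proof. by rewrite mevalXU xk oner_neq0. Qed.

Let Xk0 : cls 'X_k != 0.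
Proof. exact: cls_neq0. Qed.

Let coordO l : coord l \in O.
Proof. exact: (local_ringP (X_homog l) (X_homog k)). Qed.

Let constO c : cls c%:MP \in O.
Proof.
rewrite -[cls _]divr1 -(rmorph1 cls); apply: (local_ringP (d := 0)) (dhomog1 _ _) _.
  by rewrite -[c%:MP]mulr1 mul_mpolyC rpredZ ?dhomog1.
by rewrite meval1 oner_neq0.
Qed.

Let XkdO d H : H \is d.-homog -> H.@[x 0] != 0 -> cls 'X_k ^+ d / cls H \in O.
Proof.
move=> dH Hx; rewrite -rmorphXn; apply: (local_ringP _ dH Hx).
by have := dhomogMn d (X_homog k); rewrite mul1n.
Qed.

Let XkdVO d H : H \is d.-homog -> cls H / cls 'X_k ^+ d \in O.
Proof.
move=> dH; rewrite -rmorphXn; apply: (local_ringP dH).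
  by have := dhomogMn d (X_homog k); rewrite mul1n.
by rewrite rmorphXn /= expf_neq0.
Qed.

Let kk : coord k = 1.
Proof. by rewrite divff. Qed.

Section Evaluation.

(** Dehomogenisation with respect to 'X_k: evaluation at the affine coordinates. *)
Variable ev : {rmorphism {mpoly C[3]} -> K}.
Hypothesis evZ : forall c G, ev (c *: G) = cls c%:MP * ev G.
Hypothesis evX :
  forall n, ev 'X_[n] = coord i0 ^+ n i0 * coord i1 ^+ n i1 * coord i2 ^+ n i2.

Let ev_homog d G : G \is d.-homog -> ev G = cls G / cls 'X_k ^+ d.
Proof.
move=> /dhomogP dG; rewrite [G in LHS]mpolyE [G in RHS]mpolyE !raddf_sum /=.
rewrite mulr_suml !big_seq; apply: eq_bigr => n nG.
have nd : mdeg n = d by apply: dG.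
rewrite evZ -[in RHS]mul_mpolyC rmorphM /= -mulrA; congr (_ * _); rewrite evX.
rewrite -nd mdegE big_ord3 /= ['X_[n]]mpolyXE_id big_ord3 /= !rmorphM !rmorphXn /=.
rewrite !exprD !expr_div_n !invfM.
by ring.
Qed.

Let evX_eq n : ev 'X_[n] = \prod_l coord l ^+ n l.
Proof. by rewrite evX big_ord3 /= mulrA. Qed.

Let coordXO l n : coord l ^+ n \in O.
Proof. exact/rpredX/coordO. Qed.

Let coord_prodO (n : 'X_{1..3}) (P : pred 'I_3) :
  \prod_(l | P l) coord l ^+ n l \in O.
Proof. by apply: rpred_prod => l _; apply/rpredX/coordO. Qed.

Let evO G : ev G \in O.
Proof.
elim/mpolyind: G => [|c n G _ _ IH]; first by rewrite rmorph0 rpred0.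
rewrite rmorphD rpredD //= evZ rpredM ?constO // evX_eq.
exact: coord_prodO.
Qed.

Let ev_residue G :
  exists f g, [/\ f \in O, g \in O & ev G = cls (G.@[x 0])%:MP + al * f + be * g].
Proof.
elim/mpolyind: G => [|c n G _ _ [f [g [fO gO IH]]]].
  by exists 0, 0; rewrite rpred0 !(rmorph0, mulr0, addr0).
suff [f' [g' [fO' gO' E]]] : exists f' g', [/\ f' \in O, g' \in O
     & ev 'X_[n] = cls ('X_[n].@[x 0])%:MP + al * f' + be * g'].
  exists (cls c%:MP * f' + f), (cls c%:MP * g' + g).
  split; rewrite ?rpredD ?rpredM ?constO //.
  by rewrite rmorphD /= evZ E IH mevalD mevalZ mpolyCD mpolyCM rmorphD rmorphM /=; ring.
rewrite evX_eq mevalX; have [ni|ni] := posnP (n i); last first.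
  exists (coord i ^+ (n i).-1 * \prod_(l | l != i) coord l ^+ n l), 0.
  split; [by apply: rpredM; [exact: coordXO|exact: coord_prodO]|exact: rpred0|].
  rewrite (bigD1 i) //= [X in cls X%:MP](bigD1 i) //= xi.
  by rewrite -(prednK ni) exprS expr0n /= !mul0r mpolyC0 rmorph0 mulr0 addr0 add0r mulrA.
have [nj|nj] := posnP (n j); last first.
  exists 0; exists (coord j ^+ (n j).-1 * \prod_(l | l != j) coord l ^+ n l).
  split; [exact: rpred0|by apply: rpredM; [exact: coordXO|exact: coord_prodO]|].
  rewrite (bigD1 j) //= [X in cls X%:MP](bigD1 j) //= xj.
  by rewrite -(prednK nj) exprS expr0n /= !mul0r mpolyC0 rmorph0 mulr0 !add0r mulrA.
exists 0, 0; rewrite rpred0; split=> //.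
rewrite !mulr0 !addr0 !big1 ?mpolyC1 ?rmorph1 //= => l _.
  by case: (ijk l) => ->; rewrite ?ni ?nj ?expr0 // xk expr1n.
by case: (ijk l) => ->; rewrite ?ni ?nj ?expr0 // kk expr1n.
Qed.

(** A form of degree d becomes, after division by 'X_k ^+ d, a polynomial in [al] and [be] whose
    constant term is its value at [x]. If this value is 0, the quotient is a combination of [al] and
    [be]. *)
Lemma local_maximal_idealE u :
  m u <-> exists f g, [/\ f \in O, g \in O & u = al * f + be * g].
Proof.
split=> [/mE[d [G [H [dG dH Hx Gx ->]]]]|[_ [_ [/OE[d [G [H [dG dH Hx ->]]]]
    /OE[d' [G' [H' [dG' dH' Hx' ->]]]] ->]]]].
  have [f [g [fO gO]]] := ev_residue G.
  rewrite Gx mpolyC0 rmorph0 add0r (ev_homog dG) => E.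
  have sO := XkdO dH Hx; set s := _ / _ in sO.
  exists (f * s), (g * s); split; [exact: rpredM|exact: rpredM|].
  transitivity ((al * f + be * g) * s); last by ring.
  by rewrite -E /s mulrA divfK // expf_neq0.
apply/mE; exists (1 + (d + d'))%N, ('X_i * (G * H') + 'X_j * (G' * H)), ('X_k * (H * H')).
split.
- apply: rpredD; apply: dhomogM => //; first exact: dhomogM.
  by rewrite addnC; apply: dhomogM.
- by apply: dhomogM => //; apply: dhomogM.
- by rewrite !mevalM !mulf_neq0.
- by rewrite mevalD !mevalM !mevalXU xi xj !mul0r addr0.
- rewrite rmorphD !rmorphM /=.
  by field; rewrite !cls_neq0.
Qed.

(** A quotient of two forms of the same degree equals the quotient of their dehomogenisations, which
    lie in [O]. *)
Lemma function_fieldE z : L z <->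
  exists f g, [/\ f \in O, g \in O, g != 0 & z = f / g].
Proof.
split=> [/LE[d [G [H [dG dH H0 ->]]]]|[_ [_ [/OE[d [G [H [dG dH Hx ->]]]]
    /OE[d' [G' [H' [dG' dH' Hx' ->]]]] + ->]]]].
  exists (ev G), (ev H); rewrite !evO (ev_homog dG) (ev_homog dH).
  have Xd : cls 'X_k ^+ d != 0 by rewrite expf_neq0.
  by rewrite mulf_neq0 ?invr_eq0 //; split=> //; rewrite -mulf_div divff ?invr_eq0 // mulr1.
rewrite mulf_eq0 invr_eq0 negb_or => /andP[G0' H0'].
apply/LE; exists (d + d')%N, (G * H'), (H * G').
rewrite (dhomogM dG dH') (dhomogM dH dG'); split=> //.
  by rewrite rmorphM mulf_neq0 // cls_neq0.
by rewrite !rmorphM invf_div mulf_div.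
Qed.

Variable evb : {rmorphism {poly C} -> K}.
Hypothesis evbC : forall c, evb c%:P = cls c%:MP.
Hypothesis evbX : evb 'X = be.
Hypothesis al_integral : integralOver evb al.

Let evbO p : evb p \in O.
Proof.
elim/poly_ind: p => [|p c IH]; first by rewrite rmorph0 rpred0.
rewrite rmorphD rmorphM /= evbC evbX; apply: rpredD => //.
by apply: rpredM.
Qed.

(** [be] is in the maximal ideal, so a polynomial in [be] with nonzero constant term is a unit of
    [O]. *)
Let evbVO p : ~~ root p 0 -> (evb p)^-1 \in O /\ evb p != 0.
Proof.
move=> p0; suff nm : ~ m (evb p).
  split; first exact: (local_ring_inv (evbO p)).
  apply/eqP=> E; apply: nm; rewrite E; apply/local_maximal_idealE.
  by exists 0, 0; rewrite !mulr0 addr0 rpred0.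
move: p0; elim/poly_ind: p => [|p c _]; first by rewrite root0.
rewrite /root hornerMXaddC mulr0 add0r => c0.
rewrite rmorphD rmorphM /= evbC evbX => /local_maximal_idealE[f [g [fO gO E]]].
apply: local_maximal_ideal1; apply/local_maximal_idealE.
have cc : cls c^-1%:MP * cls c%:MP = 1.
  by rewrite -rmorphM /= -mpolyCM mulVf // rmorph1.
exists (cls c^-1%:MP * f), (cls c^-1%:MP * (g - evb p)); split.
- exact: rpredM.
- by apply: rpredM => //; apply: rpredB.
- transitivity (cls c^-1%:MP * ((al * f + be * g) - evb p * be)); last by ring.
  by rewrite -E addrC addKr cc.
Qed.

Let ev_integral G : integralOver evb (ev G).
Proof.
elim/mpolyind: G => [|c n G _ _ IH]; first by rewrite rmorph0; apply: integral0.
rewrite rmorphD /=; apply: integral_add => //.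
rewrite evZ evX_eq -evbC; apply: integral_mul; first exact: integral_id.
elim/big_ind: _ => [|y z|l _]; [exact: integral1|exact: integral_mul|].
elim: (n l) => [|e IHe]; first by rewrite expr0; apply: integral1.
rewrite exprS; apply: integral_mul => //.
case: (ijk l) => ->; first exact: al_integral.
  by rewrite -evbX; apply: integral_id.
by rewrite kk; apply: integral1.
Qed.

(** The dehomogenised numerator is integral over C[be], so it divides a nonzero c(be). Writing c =
    'X^n c' with c'(0) nonzero, the factor c'(be) is a unit of [O], and only be^n remains. *)
Lemma local_ring_dim1 f : f \in O -> f != 0 ->
  exists n h, h \in O /\ f * h = be ^+ n.
Proof.
move=> /OE[d [G [H [dG dH Hx fE]]]] f0.
have Xd0 : cls 'X_k ^+ d != 0 by rewrite expf_neq0.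
have H0 := cls_neq0 Hx.
have evG0 : ev G != 0.
  apply: contraNneq f0; rewrite (ev_homog dG) => /eqP.
  by rewrite mulf_eq0 invr_eq0 (negPf Xd0) orbF fE => /eqP ->; rewrite mul0r.
have [c [q [c0 cE]]] := integral_cofactor evG0 (ev_integral G).
have {}c0 : c != 0 by apply: contraNneq c0 => ->; rewrite rmorph0.
have [n [c' + cX]] := multiplicity_XsubC c 0; rewrite c0 /= subr0 in cX * => c'0.
have [c'VO c'0'] := evbVO c'0.
have qO : (map_poly evb q).[ev G] \in O.
  elim/poly_ind: q {cE} => [|q e IH]; first by rewrite rmorph0 horner0 rpred0.
  rewrite rmorphD rmorphM /= map_polyX map_polyC /= hornerMXaddC.
  by apply: rpredD; [apply: rpredM|].
exists n, (cls H / cls 'X_k ^+ d * (map_poly evb q).[ev G] * (evb c')^-1); split.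
  by apply: rpredM => //; apply: rpredM => //; apply: XkdVO.
move: cE; rewrite cX rmorphM rmorphXn /= evbX (ev_homog dG) => cE.
have -> : be ^+ n = (evb c' * be ^+ n) / evb c' by rewrite mulrAC divff // mul1r.
rewrite cE fE; move: (_.[_]) => s; field.
by rewrite c'0' Xd0 H0.
Qed.

End Evaluation.

Lemma unibranch_of_binomial (p q : nat) (w : K)
    (evb : {rmorphism {poly C} -> K}) :
  (forall c, evb c%:P = cls c%:MP) -> evb 'X = be -> integralOver evb al ->
  al != 0 -> be != 0 -> w \in O -> ~ m w ->
  (0 < p)%N -> (0 < q)%N -> coprime p q -> al ^+ p = w * be ^+ q ->
  exists! M, maximal_ideal_of [set z | L z /\ integral_over O z] M /\
             M `&` [set` O] = m.
Proof.
move=> evbC evbX al_int al0 be0 wO mw p0 q0 pq branch.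
have [ev [evZ _ evX]] := mpoly3_hom (cls \o @mpolyC 3 C) (fun l => coord l).
have mE' := local_maximal_idealE evZ evX.
have w0 : w != 0.
  by apply/eqP=> w0; move: branch => /eqP; rewrite w0 mul0r expf_eq0 (negPf al0) andbF.
apply: (@unique_maximal_ideal_over _ _ _ _ al be w p q) => //.
- exact: local_ring_subring.
- exact: local_maximal_ideal1.
- exact: local_ring_inv.
- exact: (function_fieldE evZ evX).
- exact: local_ring_inv.
- exact: (local_ring_dim1 evZ evX evbC evbX al_int).
Qed.

End LocalRing.

(** * Affine forms of the equation at the two cusps *)

Lemma ord3P (l : 'I_3) : [\/ l = i0, l = i1 | l = i2].
Proof.
case: l => -[|[|[|//]]] lt_l; [apply: Or31|apply: Or32|apply: Or33];
  exact: val_inj.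
Qed.

Lemma coprime_sub_self m n : (m <= n)%N -> coprime m n -> coprime (n - m) n.
Proof.
by move=> mn co; rewrite /coprime -{2}(subnK mn) gcdnDl gcdnC -gcdnDl subnKC.
Qed.

Lemma integral_trinomial (R : comNzRingType) (K : fieldType)
    (f : {rmorphism R -> K}) (z : K) (u v : R) (n k : nat) :
  (0 < k < n)%N -> z ^+ n + f u * z ^+ k + f v = 0 -> integralOver f z.
Proof.
move=> /andP[k0 kn] fz; exists ('X^n + (u%:P * 'X^k + v%:P)).
  rewrite monicE lead_coefDl ?lead_coefXn ?eqxx // size_polyXn ltnS.
  apply: leq_trans (size_polyD _ _) _; rewrite geq_max; apply/andP; split.
    rewrite mul_polyC (leq_trans (size_scale_leq _ _)) // size_polyXn //.
  by rewrite (leq_trans (size_polyC_leq1 _)) //; lia.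
rewrite /root !rmorphD rmorphM /= !map_polyXn !map_polyC /=.
by rewrite !hornerE; apply/eqP.
Qed.

Lemma XnS_dvd_coef0 (C : fieldType) n (Q : {poly C}) :
  'X^(n.+1) %| 'X^n * Q -> Q.[0] = 0.
Proof.
rewrite exprSr dvdp_mul2l ?monic_neq0 ?monicXn // => XQ.
by apply/rootP; rewrite -dvdp_XsubCl subr0.
Qed.

Lemma X2_dvd_deriv0 (C : fieldType) (p : {poly C}) :
  'X^2 %| p -> p^`().[0] = 0.
Proof.
move=> /dvdpP[q ->]; rewrite derivM derivXn hornerD !hornerM hornerMn !hornerXn.
by rewrite expr0n /= mul0rn !mulr0 addr0.
Qed.

(** The first equation is monic in X / Z, for integrality over C[Y / Z]; the second is the binomial,
    whose unit takes the value -1 where X = Y = 0. *)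
Lemma dehomogenize_x (K : fieldType) (X Y Z : K) (a b mu : nat) :
    (mu <= a)%N -> (a <= b)%N -> Z != 0 ->
    X ^+ b + X ^+ mu * Y ^+ (b - mu) + Y ^+ (b - a) * Z ^+ a = 0 ->
  (X / Z) ^+ b + (Y / Z) ^+ (b - mu) * (X / Z) ^+ mu + (Y / Z) ^+ (b - a) = 0 /\
  (X / Z) ^+ b = (- (Z ^+ a + X ^+ mu * Y ^+ (a - mu)) / Z ^+ a) * (Y / Z) ^+ (b - a).
Proof.
(* With a = mu + q and b = mu + q + p all powers split into powers of exponent mu, q and p, which
   are then treated as independent symbols. *)
move=> mu_a a_b Z0; have [q aE] : exists q, a = (mu + q)%N by exists (a - mu)%N; lia.
have [p bE] : exists p, b = (mu + q + p)%N by exists (b - a)%N; lia.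
subst a b.
rewrite (_ : (mu + q + p - mu = q + p)%N); last by lia.
rewrite (_ : (mu + q + p - (mu + q) = p)%N); last by lia.
rewrite (_ : (mu + q - mu = q)%N); last by lia.
have Zn n : Z ^+ n != 0 by rewrite expf_neq0.
rewrite !exprD !expr_div_n; move: (Zn mu) (Zn q) (Zn p).
move: (Z ^+ mu) (Z ^+ q) (Z ^+ p) (X ^+ mu) (X ^+ q) (X ^+ p) (Y ^+ q) (Y ^+ p).
move=> z1 z2 z3 x1 x2 x3 y2 y3 h1 h2 h3 E.
have E' : x1 * x2 * x3 = - (x1 * (y2 * y3) + y3 * (z1 * z2)).
  by apply/eqP; rewrite -addr_eq0 addrA E.
split.
  transitivity ((x1 * x2 * x3 + x1 * (y2 * y3) + y3 * (z1 * z2)) / (z1 * z2 * z3)).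
    by field; rewrite h1 h2 h3.
  by rewrite E mul0r.
transitivity ((x1 * x2 * x3) / (z1 * z2 * z3)); first by field; rewrite h1 h2 h3.
by rewrite E'; field; rewrite h1 h2 h3.
Qed.

(** Here X^mu (Y^(b-mu) + X^(b-mu)) is isolated, which makes the exponent of X / Y drop from b to
    mu. The factor 1 in the first equation is the coefficient expected by [integral_trinomial]. *)
Lemma dehomogenize_y (K : fieldType) (X Y Z : K) (a b mu : nat) :
    (mu <= a)%N -> (a <= b)%N -> Y != 0 -> Y ^+ (b - mu) + X ^+ (b - mu) != 0 ->
    X ^+ b + X ^+ mu * Y ^+ (b - mu) + Y ^+ (b - a) * Z ^+ a = 0 ->
  (X / Y) ^+ b + 1 * (X / Y) ^+ mu + (Z / Y) ^+ a = 0 /\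
  (X / Y) ^+ mu = (- Y ^+ (b - mu) / (Y ^+ (b - mu) + X ^+ (b - mu))) * (Z / Y) ^+ a.
Proof.
move=> mu_a a_b Y0; have [q aE] : exists q, a = (mu + q)%N by exists (a - mu)%N; lia.
have [p bE] : exists p, b = (mu + q + p)%N by exists (b - a)%N; lia.
subst a b.
rewrite (_ : (mu + q + p - mu = q + p)%N); last by lia.
rewrite (_ : (mu + q + p - (mu + q) = p)%N); last by lia.
have Yn n : Y ^+ n != 0 by rewrite expf_neq0.
rewrite !exprD !expr_div_n; move: (Yn mu) (Yn q) (Yn p).
move: (Y ^+ mu) (Y ^+ q) (Y ^+ p) (X ^+ mu) (X ^+ q) (X ^+ p) (Z ^+ mu) (Z ^+ q).
move=> y1 y2 y3 x1 x2 x3 z1 z2 h1 h2 h3 h E.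
have E' : y3 * (z1 * z2) = - (x1 * (y2 * y3 + x2 * x3)).
  by apply/eqP; rewrite -addr_eq0 -E; apply/eqP; ring.
split.
  transitivity ((x1 * x2 * x3 + x1 * (y2 * y3) + y3 * (z1 * z2)) / (y1 * y2 * y3)).
    by field; rewrite h1 h2 h3.
  by rewrite E mul0r.
transitivity (- (y3 * (z1 * z2)) / (y1 * (y2 * y3 + x2 * x3)) * y3 / y3).
  by rewrite E'; field; rewrite h h1 h3.
by field; rewrite h h1 h2 h3.
Qed.

(** * Multiplicities, and lines through a point *)

Section Lines.

Variables (C : fieldType).

Lemma mmap_comp (S : comNzRingType) (f : {rmorphism C -> S}) (h : 'I_3 -> S)
    (lq : 3.-tuple {mpoly C[3]}) (p : {mpoly C[3]}) :
  mmap f h (p \mPo lq) = mmap f (fun l => mmap f h (tnth lq l)) p.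
Proof.
elim/mpolyind: p => [|c n p _ _ IH]; first by rewrite comp_mpoly0 !mmap0.
rewrite comp_mpolyD comp_mpolyZ comp_mpolyX !mmapD !mmapZ IH mmapX.
congr (_ * _ + _); rewrite rmorph_prod /mmap1.
by apply: eq_bigr => l _; rewrite rmorphXn.
Qed.

(** On the line the displacement from x is t v, so a Taylor term of degree d contributes a multiple
    of t^d. This bounds multiplicities from above and gives access to partial derivatives. *)
Lemma multiplicity_ge_line (Gam : plane_curve C) (x v : proj_plane C) k :
  multiplicity_ge Gam x k -> line_contact_ge Gam x v k.
Proof.
move=> mult; rewrite /line_contact_ge.
have -> : line_restriction Gam x v =
    mmap (@polyC C) (fun l => v 0 l *: 'X) (taylor_at Gam x).
  rewrite /taylor_at (mmap_comp (@polyC C)); apply: eq_bigr => n _; congr (_ * _).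
  apply: mmap1_eq => l; rewrite tnth_mktuple mmapD mmapX mmap1U mmapC.
  by rewrite addrC.
apply: (big_ind (fun p => 'X^k %| p)); [exact: dvdp0|exact: dvdp_add|move=> n _].
have [nk|kn] := ltnP (mdeg n) k; first by rewrite mult // polyC0 mul0r dvdp0.
apply: dvdp_mull; rewrite /mmap1.
have -> : \prod_l (v 0 l *: 'X) ^+ n l = (\prod_l v 0 l ^+ n l) *: 'X^(mdeg n).
  under eq_bigr do rewrite exprZn.
  by rewrite scaler_prod mdegE expr_sum.
by rewrite -mul_polyC; apply/dvdp_mull/dvdp_exp2l.
Qed.

(** The condition of [multiplicity_ge], for an arbitrary polynomial in place of the Taylor
    expansion. *)
Definition order_ge (p : {mpoly C[3]}) k :=
  forall m : 'X_{1..3}, (mdeg m < k)%N -> p@_m = 0.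

Lemma order_geD p q k : order_ge p k -> order_ge q k -> order_ge (p + q) k.
Proof. by move=> pk qk m mk; rewrite mcoeffD pk // qk // addr0. Qed.

Lemma order_geMl p q k : order_ge p k -> order_ge (p * q) k.
Proof.
move=> pk m mk; rewrite mcoeffM big1 // => -[m1 m2] /= /eqP mE.
rewrite pk ?mul0r //; apply: leq_ltn_trans mk.
by apply: leq_trans (leq_addr (mdeg m2) _) _; rewrite -mdegD -mE.
Qed.

Lemma order_geX l k n : (k <= n)%N -> order_ge ('X_l ^+ n) k.
Proof.
move=> kn m mk; rewrite mpolyXn mcoeffX; case: eqP => // mE; move: mk.
by rewrite -mE mdegMn mdeg1 mul1n ltnNge kn.
Qed.

Lemma point_neq0 (l : 'I_3) : delta_mx 0 l != 0 :> 'rV[C]_3.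
Proof.
by apply/eqP=> /rowP/(_ l)/eqP; rewrite !mxE !eqxx oner_eq0.
Qed.

Definition coord_point l : proj_plane C := ProjPoint (point_neq0 l).

Lemma coord_pointE l c : coord_point l 0 c = (c == l)%:R.
Proof. by rewrite /= mxE eqxx. Qed.

Lemma coord_point_eq (z : proj_plane C) k :
  (forall c, c != k -> z 0 c = 0) -> (z == coord_point k)%MS.
Proof.
move=> zc; have zE : (z : 'rV_3) = z 0 k *: delta_mx 0 k.
  apply/rowP=> c; rewrite !mxE eqxx /=; have [->|ck] := eqVneq c k.
    by rewrite mulr1.
  by rewrite mulr0 zc.
have zk : z 0 k != 0.
  by apply: contraNneq (coords_neq0 z) => zk; rewrite zE zk scale0r.
apply/andP; split; first by rewrite zE scalemx_sub.
have -> : (coord_point k : 'rV_3) = (z 0 k)^-1 *: (z : 'rV_3).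
  by rewrite zE !mxE !eqxx mulr1 scalerA mulVf // scale1r.
exact: scalemx_sub.
Qed.

Lemma coord_line_eq (w : proj_plane C) k l :
  (forall c, [\/ c = k, c = l | w 0 c = 0]) -> k != l ->
  ~~ (coord_point k == w)%MS ->
  (col_mx (coord_point k) w == col_mx (coord_point k) (coord_point l))%MS.
Proof.
move=> wc kl kw; set ek := coord_point k; set el := coord_point l.
have wE : (w : 'rV_3) = w 0 k *: (ek : 'rV_3) + w 0 l *: (el : 'rV_3).
  apply/rowP=> c; rewrite !mxE !eqxx /=.
  case: (wc c) => [->|->|w0]; rewrite ?eqxx ?(negPf kl) 1?eq_sym ?(negPf kl) /=;
    rewrite ?mulr0 ?mulr1 ?addr0 ?add0r //.
  rewrite w0; have [ck|_] := eqVneq c k; have [cl|_] := eqVneq c l;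
    by rewrite ?mulr0 ?addr0 // -?ck -?cl w0 ?mul0r ?addr0.
have wl : w 0 l != 0.
  apply: contraNneq kw => wl.
  have : (w == ek)%MS.
    apply: coord_point_eq => c ck; case: (wc c) => [ckE||//].
      by rewrite ckE eqxx in ck.
    by move=> ->.
  by move=> /andP[H1 H2]; apply/andP.
have [kin lin] : ((ek : 'rV_3) <= col_mx ek el)%MS /\ ((el : 'rV_3) <= col_mx ek el)%MS.
  by apply/andP; rewrite -col_mx_sub.
have [kin' win] : ((ek : 'rV_3) <= col_mx ek w)%MS /\ ((w : 'rV_3) <= col_mx ek w)%MS.
  by apply/andP; rewrite -col_mx_sub.
apply/andP; split; rewrite col_mx_sub; apply/andP; split=> //.
  by rewrite [(w : 'rV_3)]wE addmx_sub ?scalemx_sub.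
have -> : (el : 'rV_3) = (w 0 l)^-1 *: ((w : 'rV_3) - w 0 k *: (ek : 'rV_3)).
  have -> : (w : 'rV_3) - w 0 k *: (ek : 'rV_3) = w 0 l *: (el : 'rV_3).
    by apply/eqP; rewrite subr_eq addrC -wE.
  by rewrite scalerA mulVf // scale1r.
by rewrite scalemx_sub // addmx_sub // -scaleNr scalemx_sub.
Qed.

Lemma coord_point_neq k l : k != l -> ~~ (coord_point k == coord_point l)%MS.
Proof.
move=> kl; apply/negP=> /andP[/sub_rVP[c /rowP/(_ k)/eqP]].
by rewrite !mxE !eqxx (negPf kl) mulr0 oner_eq0.
Qed.

End Lines.

(** * The trinomial curve: singular points and cusps *)

Section Curve.

Variables (C : numClosedFieldType) (a b mu : nat).
Hypotheses (mu_gt0 : (0 < mu)%N) (mu_lt_a : (mu < a)%N) (a_lt_b : (a < b)%N).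
Hypothesis co_ab : coprime a b.
Local Notation F := (trinomial C a b mu).

Lemma mmap_trinomial (S : comNzRingType) (f : {rmorphism C -> S}) (h : 'I_3 -> S) :
  mmap f h F = h i0 ^+ b + h i0 ^+ mu * h i1 ^+ (b - mu) + h i1 ^+ (b - a) * h i2 ^+ a.
Proof.
rewrite /trinomial !mpolyXn -!mpolyXD !mmapD !mmapX /mmap1 !big_ord3 /=.
rewrite !mnmDE !mulmnE !mnm1E /= !(mul0n, mul1n, addn0, add0n, expr0, mulr1, mul1r).
by [].
Qed.

Lemma meval_trinomial (v : 'I_3 -> C) :
  F.@[v] = v i0 ^+ b + v i0 ^+ mu * v i1 ^+ (b - mu) + v i1 ^+ (b - a) * v i2 ^+ a.
Proof. exact: (mmap_trinomial idfun). Qed.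

Let b_gt0 : (0 < b)%N. Proof. by lia. Qed.
Let a_gt0 : (0 < a)%N. Proof. by lia. Qed.
Let ba_gt0 : (0 < b - a)%N. Proof. by lia. Qed.
Let bmu_gt0 : (0 < b - mu)%N. Proof. by lia. Qed.

Let exp0 (S : nzRingType) n : (0 < n)%N -> (0 : S) ^+ n = 0.
Proof. by case: n => // n _; rewrite expr0n. Qed.

Lemma trinomial_points (l : 'I_3) : l != i0 -> F.@[coord_point C l 0] = 0.
Proof.
rewrite meval_trinomial !coord_pointE; case: (ord3P l) => -> //= _;
  by rewrite !exp0 // ?(mul0r, mulr0, addr0).
Qed.

Lemma trinomial_neq0 : F != 0.
Proof.
apply/eqP=> F0; have := meval_trinomial (fun l => (l == i0)%:R).
rewrite F0 meval0 /= !expr1n !exp0 // !(mulr0, addr0) => /eqP.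
by rewrite eq_sym oner_eq0.
Qed.

Lemma trinomial_proper : 1 \notin principal_ideal F.
Proof.
apply/negP=> /asboolP[Q /(congr1 (meval (coord_point C i1 0)))/eqP].
by rewrite meval1 mevalM trinomial_points // mulr0 oner_eq0.
Qed.

Lemma trinomial_prime_idealr : prime_idealr_closed (principal_ideal F).
Proof.
have b0 : (0 < b)%N by lia.
by move=> G H; apply: (trinomial_prime mu_gt0 mu_lt_a a_lt_b co_ab (rootCK b0 (-1))).
Qed.

Definition trinomial_curve : plane_curve C :=
  PlaneCurve (trinomial_homog C mu_lt_a a_lt_b) trinomial_neq0
    trinomial_proper trinomial_prime_idealr.

Local Notation Gam := trinomial_curve.
Local Notation x := (coord_point C i2).
Local Notation y := (coord_point C i1).

(** The cofactor of 'X^(b - a) has value v_1^(b-a) at 0, so the contact exceeds b - a only on the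
    line 'X_i1 = 0. *)
Lemma line_restriction_x (v : proj_plane C) : line_restriction Gam x v =
  'X^(b - a) * ('X^a * ((v 0 i0 ^+ b)%:P + (v 0 i0 ^+ mu * v 0 i1 ^+ (b - mu))%:P)
                + (v 0 i1 ^+ (b - a))%:P * (1 + v 0 i2 *: 'X) ^+ a).
Proof.
rewrite /line_restriction (mmap_trinomial polyC) !coord_pointE /=.
rewrite !polyC0 !add0r !exprZn polyC1 -!mul_polyC !rmorphM.
have Xb : 'X^b = 'X^(b - a) * 'X^a :> {poly C} by rewrite -exprD subnK // ltnW.
have Xb' : 'X^mu * 'X^(b - mu) = 'X^b :> {poly C}.
  by rewrite -exprD subnKC // ltnW // (ltn_trans mu_lt_a).
rewrite mulrACA Xb' Xb; move: ((1 + _) ^+ a) => s; ring.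
Qed.

(** The cofactor of 'X^mu has value v_0^mu at 0, which singles out the line 'X_i0 = 0. *)
Lemma line_restriction_y (v : proj_plane C) : line_restriction Gam y v =
  'X^mu * ((v 0 i0 ^+ b)%:P * 'X^(b - mu)
           + (v 0 i0 ^+ mu)%:P * (1 + v 0 i1 *: 'X) ^+ (b - mu)
           + 'X^(a - mu) * ((1 + v 0 i1 *: 'X) ^+ (b - a) * (v 0 i2 ^+ a)%:P)).
Proof.
rewrite /line_restriction (mmap_trinomial polyC) !coord_pointE /=.
rewrite !polyC0 !add0r !exprZn polyC1 -!mul_polyC.
have Xa : 'X^a = 'X^mu * 'X^(a - mu) :> {poly C} by rewrite -exprD subnKC // ltnW.
have Xb : 'X^b = 'X^mu * 'X^(b - mu) :> {poly C}.
  by rewrite -exprD subnKC // ltnW // (ltn_trans mu_lt_a).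
rewrite Xb Xa; move: ((1 + _) ^+ _) ((1 + _) ^+ _) => s s'; ring.
Qed.

Lemma line_contact_x (v : proj_plane C) :
  line_contact_ge Gam x v (b - a).+1 -> v 0 i1 = 0.
Proof.
rewrite /line_contact_ge line_restriction_x => /XnS_dvd_coef0.
rewrite -polyC1 !(hornerD, hornerM, horner_exp, hornerXn, hornerC, hornerZ, hornerX).
rewrite mulr0 addr0 expr1n mulr1 [0 ^+ a]exp0 // mul0r add0r => /eqP.
by rewrite expf_eq0 => /andP[_ /eqP].
Qed.

Lemma line_contact_y (v : proj_plane C) :
  line_contact_ge Gam y v mu.+1 -> v 0 i0 = 0.
Proof.
rewrite /line_contact_ge line_restriction_y => /XnS_dvd_coef0.
rewrite -polyC1 !(hornerD, hornerM, horner_exp, hornerXn, hornerC, hornerZ, hornerX).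
rewrite !mulr0 addr0 !expr1n mulr1 [0 ^+ (b - mu)]exp0 // [0 ^+ (a - mu)]exp0 ?subn_gt0 //.
rewrite mulr0 mul0r add0r addr0 => /eqP.
by rewrite expf_eq0 => /andP[_ /eqP].
Qed.

Lemma taylorE (p : proj_plane C) : taylor_at Gam p =
  ('X_i0 + (p 0 i0)%:MP) ^+ b
  + ('X_i0 + (p 0 i0)%:MP) ^+ mu * ('X_i1 + (p 0 i1)%:MP) ^+ (b - mu)
  + ('X_i1 + (p 0 i1)%:MP) ^+ (b - a) * ('X_i2 + (p 0 i2)%:MP) ^+ a.
Proof.
by rewrite /taylor_at /comp_mpoly (mmap_trinomial (@mpolyC 3 C)) !tnth_mktuple.
Qed.

Lemma multiplicity_x : multiplicity Gam x (b - a).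
Proof.
(* A larger multiplicity would give every line through x contact above b - a, in particular the one
   towards [0:1:0], which is not the tangent. *)
split=> [|/(multiplicity_ge_line (coord_point C i1))].
  rewrite /multiplicity_ge taylorE !coord_pointE /= mpolyC0 !addr0.
  apply: order_geD; [apply: order_geD|by apply/order_geMl/order_geX].
    by apply: order_geX; apply: leq_subr.
  by rewrite mulrC; apply/order_geMl/order_geX; lia.
by move/line_contact_x/eqP; rewrite coord_pointE oner_eq0.
Qed.

Lemma multiplicity_y : multiplicity Gam y mu.
Proof.
split=> [|/(multiplicity_ge_line (coord_point C i0))].
  rewrite /multiplicity_ge taylorE !coord_pointE /= mpolyC0 !addr0.
  apply: order_geD; [apply: order_geD|].
  - by apply: order_geX; lia.
  - by apply/order_geMl/order_geX.
  - by rewrite mulrC; apply/order_geMl/order_geX; lia.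
by move/line_contact_y/eqP; rewrite coord_pointE oner_eq0.
Qed.

Let dvd_XnS n : ~~ ('X^(n.+1) %| ('X^n : {poly C})).
Proof.
apply/negP=> /(dvdp_leq (monic_neq0 (monicXn C n))).
by rewrite !size_polyXn ltnn.
Qed.

Lemma flex_line_x : line_contact Gam x (coord_point C i0) b.
Proof.
have E : line_restriction Gam x (coord_point C i0) = 'X^b.
  rewrite line_restriction_x !coord_pointE /= !expr1n !exp0 //.
  by rewrite polyC1 mulr0 polyC0 addr0 mulr1 mul0r addr0 -exprD subnK // ltnW.
by rewrite /line_contact /line_contact_ge E dvdpp; split=> //; apply/negP/dvd_XnS.
Qed.

Lemma flex_line_y : line_contact Gam y (coord_point C i2) a.
Proof.
have E : line_restriction Gam y (coord_point C i2) = 'X^a.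
  rewrite line_restriction_y !coord_pointE /= !expr1n !exp0 //.
  rewrite polyC0 !mul0r !add0r scale0r addr0 expr1n mul1r polyC1 mulr1 -exprD.
  by rewrite subnKC // ltnW.
by rewrite /line_contact /line_contact_ge E dvdpp; split=> //; apply/negP/dvd_XnS.
Qed.

(** The equation and the partial derivatives in 'X_i0 and 'X_i2 suffice; the latter are the
    derivatives at 0 of the restrictions along the coordinate directions. Characteristic 0 allows
    division by a, b - mu and b. *)
Lemma trinomial_singular (z : proj_plane C) :
  on_curve Gam z -> singular_point Gam z -> (z == x)%MS || (z == y)%MS.
Proof.
move=> z_on z_sing.
have part2 : z 0 i1 ^+ (b - a) * (z 0 i2 ^+ a.-1 *+ a) = 0.
  have := multiplicity_ge_line (coord_point C i2) z_sing.
  rewrite /line_contact_ge /line_restriction (mmap_trinomial polyC) !coord_pointE /=.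
  rewrite !scale0r !addr0 scale1r -!rmorphXn -rmorphM /= => /X2_dvd_deriv0.
  rewrite !derivD !derivC !add0r derivM derivC mul0r add0r deriv_exp derivD derivC derivX.
  by rewrite add0r mul1r !(hornerM, hornerMn, horner_exp, hornerD, hornerC, hornerX) addr0.
have part0 : z 0 i0 ^+ b.-1 *+ b + z 0 i0 ^+ mu.-1 *+ mu * z 0 i1 ^+ (b - mu) = 0.
  have := multiplicity_ge_line (coord_point C i0) z_sing.
  rewrite /line_contact_ge /line_restriction (mmap_trinomial polyC) !coord_pointE /=.
  rewrite !scale0r !addr0 scale1r -!rmorphXn -rmorphM /= => /X2_dvd_deriv0.
  rewrite !derivD !derivC !addr0 derivM derivC mulr0 addr0 !deriv_exp !derivD !derivC !derivX.
  by rewrite add0r !mul1r !(hornerD, hornerM, hornerMn, horner_exp, hornerC, hornerX) !addr0.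
move: z_on; rewrite /on_curve /= meval_trinomial => z_on.
have pow0 (c : C) n : c ^+ n = 0 -> c = 0.
  by move/eqP; rewrite expf_eq0 => /andP[_ /eqP].
have [z1|z1] := eqVneq (z 0 i1) 0.
  have z0 : z 0 i0 = 0.
    by apply: (pow0 _ b); rewrite -z_on z1 !exp0 // mulr0 mul0r !addr0.
  apply/orP; left; apply: coord_point_eq => c.
  by case: (ord3P c) => -> //; rewrite eqxx.
have z2 : z 0 i2 = 0.
  move/eqP: part2; rewrite mulf_eq0 expf_eq0 (negPf z1) andbF /= mulrn_eq0.
  by rewrite gtn_eqF //= => /eqP/pow0.
have z0 : z 0 i0 = 0.
  rewrite z2 exp0 // mulr0 addr0 in z_on.
  (* The combination z_0 dF/dX_0 - mu F eliminates the middle term and leaves (b - mu) z_0^b. *)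
  have : z 0 i0 ^+ b *+ (b - mu) = 0.
    have := congr1 (fun s => z 0 i0 * s) part0.
    rewrite mulr0 mulrDr mulrA !mulrnAr -!exprS !prednK // => E.
    rewrite mulrnBr; last by lia.
    have := congr1 (fun s => s *+ mu) z_on; rewrite mul0rn mulrnDl => E'.
    apply/eqP; rewrite subr_eq0; apply/eqP.
    apply: (addIr (z 0 i0 ^+ mu * z 0 i1 ^+ (b - mu) *+ mu)); rewrite E'.
    by rewrite -mulrnAl.
  by move/eqP; rewrite mulrn_eq0 gtn_eqF //= => /eqP/pow0.
apply/orP; right; apply: coord_point_eq => c.
by case: (ord3P c) => -> //; rewrite eqxx.
Qed.

Local Notation K := (hcr_fraction Gam).
Local Notation cls := (@hcr_class C Gam).

Lemma hcr_class_vanish (v : 'I_3 -> C) (H : {mpoly C[3]}) :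
  F.@[v] = 0 -> cls H = 0 -> H.@[v] = 0.
Proof.
move=> Fv /eqP; rewrite hcr_class_eq0 => /asboolP[Q ->].
by rewrite mevalM Fv mulr0.
Qed.

Lemma hcr_class_coord_neq0 (l : 'I_3) : cls 'X_l != 0.
Proof.
have r0 : a.-root (- 2%:R) != 0 :> C.
  by rewrite rootC_eq0 // oppr_eq0 pnatr_eq0.
(* A point of the curve with no zero coordinate: its three terms are 1, 1 and -2. *)
pose v (l : 'I_3) : C := if l == i2 then a.-root (- 2%:R) else 1.
apply/eqP=> /(@hcr_class_vanish v) E; have /eqP : v l = 0.
  rewrite -mevalXU; apply: E; rewrite meval_trinomial /v /= !expr1n mul1r mul1r.
  by rewrite rootCK //; apply: (subrr 2%:R).
by rewrite /v; case: ifP => _; rewrite ?(negPf r0) ?oner_eq0.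
Qed.

Lemma hcr_class_trinomial : cls F = 0.
Proof. by apply/eqP; rewrite hcr_class_eq0; apply/asboolP; exists 1; rewrite mul1r. Qed.

(** Two equations for [al] are required separately: a monic one over C[be], for finiteness, and a
    binomial one with the unit G / H, for the branch. At y their degrees in [al] differ, being b and
    mu. *)
Lemma is_cusp_of_binomial (x : proj_plane C) (i j k : 'I_3) (p q : nat)
    (n e d : nat) (u v : {poly C}) (G H : {mpoly C[3]}) :
  on_curve Gam x -> (forall l, [\/ l = i, l = j | l = k]) ->
  x 0 i = 0 -> x 0 j = 0 -> x 0 k = 1 ->
  let al := cls 'X_i / cls 'X_k in let be := cls 'X_j / cls 'X_k in
  let ev s := (map_poly (cls \o @mpolyC 3 C) s).[be] in
  (0 < e < n)%N -> al ^+ n + ev u * al ^+ e + ev v = 0 ->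
  G \is d.-homog -> H \is d.-homog -> G.@[x 0] != 0 -> H.@[x 0] != 0 ->
  (0 < p)%N -> (0 < q)%N -> coprime p q ->
  al ^+ p = cls G / cls H * be ^+ q ->
  is_cusp Gam x.
Proof.
move=> x_on ijk xi xj xk al be ev en al_eq dG dH Gx Hx p0 q0 pq branch.
have vanish D := @hcr_class_vanish (x 0) D x_on.
have nz D : D.@[x 0] != 0 -> cls D != 0.
  by apply: contra => /eqP/vanish ->.
have comm : commr_rmorph (cls \o @mpolyC 3 C) be by move=> c; apply: mulrC.
pose evb : {rmorphism {poly C} -> K} := horner_morph comm.
have al_int := @integral_trinomial _ _ evb al u v n e en al_eq.
have evbC c : evb c%:P = cls c%:MP by rewrite /evb /= horner_morphC.
have evbX : evb 'X = be by rewrite /evb /= horner_morphX.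
have al0 : al != 0 by rewrite mulf_neq0 ?invr_eq0 ?hcr_class_coord_neq0.
have be0 : be != 0 by rewrite mulf_neq0 ?invr_eq0 ?hcr_class_coord_neq0.
have wO : cls G / cls H \in local_ring Gam x by apply/asboolP; exists d, G, H.
have wm : ~ local_maximal_ideal Gam x (cls G / cls H).
  move=> [d' [G' [H' [_ _ Hx' Gx' /eqP]]]].
  rewrite eqr_div ?nz // -!rmorphM /= -subr_eq0 -rmorphB /= => /eqP/vanish/eqP.
  by rewrite mevalB !mevalM Gx' mul0r subr0 mulf_eq0 (negPf Gx) (negPf Hx').
split=> //.
apply: (@unibranch_of_binomial C K cls (x : 'rV_3) (local_ring Gam x)
  (local_maximal_ideal Gam x) (function_field Gam) vanish _ _ _ i j k ijk
  xi xj xk p q _ evb evbC evbX al_int al0 be0 wO wm p0 q0 pq branch) => //.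
by move=> z; split=> /asboolP.
Qed.

Let X_homog (l : 'I_3) n : ('X_l ^+ n : {mpoly C[3]}) \is n.-homog.
Proof.
have h1 : ('X_l : {mpoly C[3]}) \is 1.-homog by rewrite dhomogX /= mdeg1.
by have := dhomogMn n h1; rewrite mul1n.
Qed.

Let cls_eq : cls 'X_i0 ^+ b + cls 'X_i0 ^+ mu * cls 'X_i1 ^+ (b - mu)
  + cls 'X_i1 ^+ (b - a) * cls 'X_i2 ^+ a = 0.
Proof.
rewrite -!rmorphXn -!rmorphM -!rmorphD; exact: hcr_class_trinomial.
Qed.

Let x_on : on_curve Gam x. Proof. exact: trinomial_points. Qed.
Let y_on : on_curve Gam y. Proof. exact: trinomial_points. Qed.

Lemma is_cusp_x : is_cusp Gam x.
Proof.
have [E1 E2] := dehomogenize_x (ltnW mu_lt_a) (ltnW a_lt_b)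
  (hcr_class_coord_neq0 i2) cls_eq.
(* Here [al] = X0 / X2, [be] = X1 / X2, and the unit is a quotient of forms of degree a. *)
apply: (@is_cusp_of_binomial x i0 i1 i2 b (b - a) b mu a 'X^(b - mu) 'X^(b - a)
  (- ('X_i2 ^+ a + 'X_i0 ^+ mu * 'X_i1 ^+ (a - mu))) ('X_i2 ^+ a)) => //.
- exact: ord3P.
- by rewrite coord_pointE.
- by rewrite coord_pointE.
- by rewrite coord_pointE.
- by rewrite mu_gt0 (ltn_trans mu_lt_a).
- by rewrite !map_polyXn !hornerXn.
- rewrite rpredN rpredD //.
  by have := dhomogM (X_homog i0 mu) (X_homog i1 (a - mu)); rewrite subnKC // ltnW.
- rewrite mevalN mevalD !mevalM !rmorphXn /= !mevalXU !coord_pointE /= expr1n.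
  by rewrite exp0 // mul0r addr0 oppr_eq0 oner_eq0.
- by rewrite rmorphXn /= !mevalXU coord_pointE expr1n oner_eq0.
- by rewrite coprime_sym coprime_sub_self // ltnW.
- by rewrite rmorphN rmorphD rmorphM !rmorphXn.
Qed.

Lemma cusp_of_type_x : cusp_of_type Gam x (b - a) b.
Proof.
split; [exact: is_cusp_x|exact: multiplicity_x|split; first by lia].
exists (coord_point C i0); split; first exact: coord_point_neq.
  exact: flex_line_x.
move=> w xw /line_contact_x w1; apply: coord_line_eq => // c.
by case: (ord3P c) => ->; [apply: Or32|apply: Or33|apply: Or31].
Qed.

Hypothesis co_mua : coprime mu a.

Lemma is_cusp_y : is_cusp Gam y.
Proof.
have D0 : cls ('X_i1 ^+ (b - mu) + 'X_i0 ^+ (b - mu)) != 0.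
  apply/eqP=> /(@hcr_class_vanish (y 0) _ y_on)/eqP.
  rewrite mevalD !rmorphXn /= !mevalXU !coord_pointE /= expr1n exp0 // addr0.
  by rewrite oner_eq0.
have D0' := D0; rewrite rmorphD !rmorphXn /= in D0'.
have [E1 E2] := dehomogenize_y (ltnW mu_lt_a) (ltnW a_lt_b)
  (hcr_class_coord_neq0 i1) D0' cls_eq.
(* Here [al] = X0 / X1, [be] = X2 / X1, and the unit is a quotient of forms of degree b - mu. *)
apply: (@is_cusp_of_binomial y i0 i2 i1 mu a b mu (b - mu) 1 'X^a
  (- 'X_i1 ^+ (b - mu)) ('X_i1 ^+ (b - mu) + 'X_i0 ^+ (b - mu))) => //.
- by move=> l; case: (ord3P l) => ->; [apply: Or31|apply: Or33|apply: Or32].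
- by rewrite coord_pointE.
- by rewrite coord_pointE.
- by rewrite coord_pointE.
- by rewrite mu_gt0 (ltn_trans mu_lt_a).
- by rewrite map_polyXn hornerXn rmorph1 hornerC.
- by rewrite rpredN.
- by rewrite rpredD.
- by rewrite mevalN rmorphXn /= !mevalXU coord_pointE expr1n oppr_eq0 oner_eq0.
- rewrite mevalD !rmorphXn /= !mevalXU !coord_pointE /= expr1n exp0 // addr0.
  exact: oner_neq0.
- by rewrite rmorphN rmorphD !rmorphXn.
Qed.

Lemma cusp_of_type_y : cusp_of_type Gam y mu a.
Proof.
split; [exact: is_cusp_y|exact: multiplicity_y|split; first by lia].
exists (coord_point C i2); split; first exact: coord_point_neq.
  exact: flex_line_y.
move=> w yw /line_contact_y w0; apply: coord_line_eq => // c.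
by case: (ord3P c) => ->; [apply: Or33|apply: Or31|apply: Or32].
Qed.

End Curve.

Theorem lemma8 (R : realType) (a b n r : nat)
    (ha : (0 < a)%N) (hab : (a < b)%N) (hgcd : gcdn a b = 1%N)
    (hb : b = (n * a + r)%N) (hn : (1 <= n)%N) (hr : (0 < r < a)%N) :
  let mu := (a - r)%N in
  exists Gam : plane_curve R[i],
    curve_degree Gam = b /\
    exists x y : proj_plane R[i],
      [/\ ~~ (x == y)%MS,
          cusp_of_type Gam x (b - a) b,
          cusp_of_type Gam y mu a
        & forall z : proj_plane R[i],
            on_curve Gam z -> singular_point Gam z ->
            (z == x)%MS || (z == y)%MS].
Proof.
move=> mu.
have mu_gt0 : (0 < mu)%N by rewrite /mu; lia.
have mu_lt_a : (mu < a)%N by rewrite /mu; lia.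
have co_ab : coprime a b by rewrite /coprime hgcd.
(* From b = n a + r: gcd(a - r, a) = gcd(r, a) = gcd(b, a) = 1. *)
have co_mua : coprime mu a.
  have [_ /ltnW ra] := andP hr; apply: coprime_sub_self => //.
  by rewrite coprime_sym /coprime -(gcdnMDl n) -hb hgcd.
exists (@trinomial_curve R[i] a b mu mu_gt0 mu_lt_a hab co_ab); split=> //.
exists (coord_point _ (Ordinal (isT : (2 < 3)%N))), (coord_point _ (Ordinal (isT : (1 < 3)%N))).
split.
- exact: coord_point_neq.
- exact: cusp_of_type_x.
- exact: cusp_of_type_y.
- exact: trinomial_singular.
Qed.
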